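(* Let $K$ be a (nonempty) compact metric space, let $d\ge1$ be an integer, and let $\mathcal{F}=\mathcal{F}(K,d)$ be the space of continuous functions from $K$ to $\mathbb{R}^d$, endowed with the metric induced by the supremum norm. Schmidt's game is played on the complete metric space $\mathcal{F}$. Then: (i) If $\dim_T(K)\ge d$, then the set $\{\mathbf{f}\in\mathcal{F} : \mathbf{f}(K)\text{ has nonempty interior}\}$ is winning. (ii) If $\dim_T(K)<d$, then the set $\{\mathbf{f}\in\mathcal{F} : \dim_A(\mathbf{f}(K))<d\}$ is winning. (iii) If $K$ is uncountable, then the set $\{\mathbf{f}\in\mathcal{F} : \dim_H(\mathbf{f}(K))>0\}$ is winning. (iv) If $\dim_T(K)\le d$, then the set $\{\mathbf{f}\in\mathcal{F} : \mathcal{H}^{\dim_T(K)}(\mathbf{f}(K))>0\}$ is winning. In particular, the set $\{\mathbf{f}\in\mathcal{F} : \dim_H(\mathbf{f}(K))\ge\dim_T(K)\}$ is winning.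
   Context: **Schmidt's game.** Let $(Y,\rho)$ be a complete metric space and $0<\alpha,\beta<1$. The $(\alpha,\beta)$-game between Alice and Bob: Bob first chooses $r_0>0$ and $x_0\in Y$. Put $r_n=(\alpha\beta)^n r_0$. For $n=1,2,\dots$: Alice chooses $y_n\in Y$ with $\rho(x_{n-1},y_n)+\alpha r_{n-1}\le r_{n-1}$; then Bob chooses $x_n\in Y$ with $\rho(y_n,x_n)+\alpha\beta r_{n-1}\le \alpha r_{n-1}$. The closed balls $B_n=B(x_n,r_n)$ and $A_n=B(y_n,\alpha r_{n-1})$ satisfy $B_0\supseteq A_1\supseteq B_1\supseteq A_2\supseteq\cdots$ and intersect in a unique point, called the outcome. A set $S\subseteq Y$ is $(\alpha,\beta)$-winning if Alice has a strategy guaranteeing that the outcome lies in $S$; it is $\alpha$-winning if it is $(\alpha,\beta)$-winning for all $0<\beta<1$; it is winning if it is $\alpha$-winning for some $0<\alpha<1$. **Dimensions.** An $r$-cover of a set is a cover by sets of diameter at most $r$. - The topological dimension $\dim_T(K)$ is the minimal integer $n\ge0$ such that for every $r>0$ there exists an $r$-cover of $K$ by open sets such that every point of $K$ lies in at most $n+1$ of the covering sets ($\dim_T(K)=\infty$ if there is no such $n$). - $\mathcal{H}^s$ is the $s$-dimensional Hausdorff (outer) measure, $\mathcal{H}^s(E)=\lim_{r\to0}\inf\{\sum_i\mathrm{diam}(U_i)^s : \{U_i\}_i\text{ is a countable }r\text{-cover of }E\}$ (so $\mathcal{H}^0$ is counting measure), and $\dim_H$ is the Hausdorff dimension, $\dim_H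 E=\inf\{s\ge0:\mathcal{H}^s(E)=0\}$. - $N_r(E)$ is the minimal number of open sets of diameter at most $r$ required to cover $E$, and the Assouad dimension $\dim_A E$ is the infimum of all $s\ge0$ for which there is a constant $C>0$ such that for all $0<r<R$ and all $x\in E$, $N_r(B(x,R)\cap E)\le C(R/r)^s$. *)

(* Defs.v *)
From HB Require Import structures.
From mathcomp Require Import all_boot all_order all_algebra.
From mathcomp Require Import all_classical all_reals all_analysis.
From mathcomp Require Import ring lra.

Set Implicit Arguments.
Unset Strict Implicit.
Unset Printing Implicit Defensive.

Import Order.TTheory GRing.Theory Num.Theory.
Import numFieldNormedType.Exports.

Local Open Scope classical_set_scope.
Local Open Scope ring_scope.

(* The library's [completeType] is pointed, so these are nonempty complete
   metric spaces. *)
#[short(type="completeMetricType")]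
HB.structure Definition CompleteMetric (R : numDomainType) :=
  {T of Metric R T & Complete T}.

(* The library metrizes ['rV[R]_d] by the max norm; [euclidean R d] is the
   same set of vectors with the Euclidean metric. *)
Definition euclidean (R : realType) (d : nat) : Type := 'rV[R]_d.

Section EuclideanMetric.
Context {R : realType} {d : nat}.
Implicit Types x y z : euclidean R d.

Definition eucl_norm (v : 'rV[R]_d) : R :=
  Num.sqrt (\sum_(i < d) v ord0 i ^+ 2).

Definition eucl_dist x y : R :=
  eucl_norm ((x : 'rV[R]_d) - (y : 'rV[R]_d)).

Lemma eucl_norm_coord (v : 'rV[R]_d) i : `|v ord0 i| <= eucl_norm v.
Proof.
rewrite -sqrtr_sqr ler_wsqrtr// (bigD1 i)//= lerDl.
by apply: sumr_ge0 => j _; exact: sqr_ge0.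
Qed.

Lemma eucl_norm_le_sum (v : 'rV[R]_d) :
  eucl_norm v <= \sum_(i < d) `|v ord0 i|.
Proof.
have s0 : 0 <= \sum_(i < d) `|v ord0 i| by apply: sumr_ge0.
rewrite -[leRHS]ger0_norm// -sqrtr_sqr ler_wsqrtr// expr2 big_distrl/=.
apply: ler_sum => i _.
rewrite -real_normK ?num_real// expr2 ler_wpM2l//.
by rewrite (bigD1 i)//= lerDl; apply: sumr_ge0.
Qed.

Lemma cauchy_schwarz_sum (a b : 'I_d -> R) :
  (\sum_i a i * b i) ^+ 2 <= (\sum_i a i ^+ 2) * (\sum_i b i ^+ 2).
Proof.
set A := \sum_i a i ^+ 2; set B := \sum_i b i ^+ 2.
set C := \sum_i a i * b i.
have A0 : 0 <= A by apply: sumr_ge0 => i _; exact: sqr_ge0.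
have [Az|An] := eqVneq A 0.
  have az i : a i = 0.
    have h j : true -> 0 <= a j ^+ 2 by move=> _; exact: sqr_ge0.
    move/eqP : Az; rewrite psumr_eq0// => /allP/(_ i).
    by rewrite mem_index_enum => /(_ isT)/=; rewrite sqrf_eq0 => /eqP.
  suff -> : C = 0 by rewrite Az mul0r expr0n.
  by apply: big1 => i _; rewrite az mul0r.
have Agt : 0 < A by rewrite lt_neqAle eq_sym An.
have : 0 <= \sum_i (A * b i - C * a i) ^+ 2.
  by apply: sumr_ge0 => i _; exact: sqr_ge0.
have -> : \sum_i (A * b i - C * a i) ^+ 2 = A * (A * B - C ^+ 2).
  transitivity (\sum_i (A ^+ 2 * b i ^+ 2 - (2 * A * C) * (a i * b i)
                        + C ^+ 2 * a i ^+ 2)).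
    by apply: eq_bigr => i _; ring.
  rewrite big_split/= sumrB -!mulr_sumr -/A -/B -/C; ring.
by rewrite pmulr_rge0// subr_ge0.
Qed.

Lemma eucl_normD (u v : 'rV[R]_d) :
  eucl_norm (u + v) <= eucl_norm u + eucl_norm v.
Proof.
have n0 (w : 'rV[R]_d) : 0 <= eucl_norm w by exact: sqrtr_ge0.
have s0 (w : 'rV[R]_d) : 0 <= \sum_i w ord0 i ^+ 2.
  by apply: sumr_ge0 => i _; exact: sqr_ge0.
have sq (w : 'rV[R]_d) : eucl_norm w ^+ 2 = \sum_i w ord0 i ^+ 2.
  exact: sqr_sqrtr.
rewrite -(@ler_pXn2r _ 2)// ?nnegrE ?addr_ge0//.
rewrite sqrrD !sq.
have -> : \sum_i (u + v) ord0 i ^+ 2 =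
    \sum_i u ord0 i ^+ 2 + (\sum_i u ord0 i * v ord0 i) *+ 2
    + \sum_i v ord0 i ^+ 2.
  rewrite -mulr_natr mulr_suml -!big_split/=; apply: eq_bigr => i _.
  by rewrite mxE; ring.
rewrite lerD2r lerD2l lerMn2r/=.
rewrite (le_trans (ler_norm _))// -sqrtr_sqr /eucl_norm -sqrtrM//.
by rewrite ler_wsqrtr// cauchy_schwarz_sum.
Qed.

HB.instance Definition _ := Choice.copy (euclidean R d) 'rV[R]_d.

Let eucl_distxx x : eucl_dist x x = 0.
Proof.
rewrite /eucl_dist subrr /eucl_norm big1 ?sqrtr0// => i _.
by rewrite mxE expr0n.
Qed.

Let eucl_dist_positivity x y : eucl_dist x y = 0 -> x = y.
Proof.
move=> xy; apply/rowP => i; apply/eqP; rewrite -subr_eq0 -normr_le0.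
by have := eucl_norm_coord ((x : 'rV_d) - y) i; rewrite -/(eucl_dist x y) xy !mxE.
Qed.

Let eucl_dist_sym x y : eucl_dist x y = eucl_dist y x.
Proof.
by congr Num.sqrt; apply: eq_bigr => i _; rewrite !mxE -sqrrN opprB.
Qed.

Let eucl_dist_triangle y x z : eucl_dist x z <= eucl_dist x y + eucl_dist y z.
Proof.
rewrite (le_trans _ (eucl_normD _ _))//.
by rewrite addrA subrK.
Qed.

HB.instance Definition _ := isMetric.Build R (euclidean R d)
  eucl_distxx eucl_dist_positivity eucl_dist_sym eucl_dist_triangle.

HB.instance Definition _ := isPointed.Build (euclidean R d) (0 : 'rV[R]_d).

Lemma eucl_mdistE x y : mdist x y = eucl_dist x y.
Proof. by []. Qed.

Let eucl_complete (F : set_system (euclidean R d)) :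
  ProperFilter F -> cauchy F -> cvg F.
Proof.
move=> FF /cauchy_ballP Fc.
pose c (i : 'I_d) (v : euclidean R d) : R^o := (v : 'rV[R]_d) ord0 i.
have cc i : cvg (c i @ F).
  apply/cauchy_cvgP/cauchy_ballP => e e0.
  rewrite near_map2.
  apply: filterS (Fc _ e0) => -[x y] /=; rewrite ballEmdist /= eucl_mdistE => xy.
  rewrite /ball/= (le_lt_trans _ xy)//.
  by have := eucl_norm_coord ((x : 'rV[R]_d) - y) i; rewrite !mxE.
apply/cvg_ex; exists (\row_i lim (c i @ F) : 'rV[R]_d).
apply/cvg_ballP => e e0; rewrite near_simpl.
have e1 : 0 < e / d.+1%:R by rewrite divr_gt0.
have : \forall v \near F, forall i, `|lim (c i @ F) - c i v| < e / d.+1%:R.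
  by apply: filter_forall => i; move/cvgrPdist_lt : (cc i); exact.
apply: filterS => v vF; rewrite ballEmdist/= eucl_mdistE.
rewrite (le_lt_trans (eucl_norm_le_sum _))//.
apply: (@le_lt_trans _ _ (\sum_(i < d) e / d.+1%:R)).
  by apply: ler_sum => i _; rewrite !mxE ltW.
rewrite sumr_const card_ord -[ltLHS]mulr_natl mulrCA gtr_pMr//.
by rewrite ltr_pdivrMr// mul1r ltr_nat.
Qed.

HB.instance Definition _ :=
  Uniform_isComplete.Build (euclidean R d) eucl_complete.

End EuclideanMetric.

(* The compactness proof is a parameter of the type because the supremum
   distance is a metric only when the distances [mdist (f x) (g x)] are
   bounded. *)
Definition cfun (R : realType) (K : topologicalType) (Y : metricType R)
  (cK : compact [set: K]) : Type := continuousType K Y.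

Section SupMetric.
Context {R : realType} {K : topologicalType}.

Section Metric.
Context {Y : metricType R} (cK : compact [set: K]).
Implicit Types f g h : continuousType K Y.

Definition sup_dist f g : R := sup (range (fun x => mdist (f x) (g x))).

Lemma continuous_mdist f g : continuous (fun x => mdist (f x) (g x) : R^o).
Proof.
move=> x; apply/cvgrPdist_lt => e e0.
have e2 : 0 < e / 2 by rewrite divr_gt0.
have /cvg_ballP/(_ _ e2) fx := @cts_fun _ _ f x.
have /cvg_ballP/(_ _ e2) gx := @cts_fun _ _ g x.
near=> t.
have : ball (f x) (e / 2) (f t) by near: t; exact: fx.
have : ball (g x) (e / 2) (g t) by near: t; exact: gx.
rewrite !ballEmdist/= => gt ft.
have := metric_triangle (f x) (f t) (g x).
have := metric_triangle (f t) (g t) (g x).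
have := metric_triangle (f t) (f x) (g t).
have := metric_triangle (f x) (g x) (g t).
rewrite (metric_sym (f t) (f x)) (metric_sym (g t) (g x)).
by rewrite ltr_norml => *; apply/andP; split; lra.
Unshelve. all: by end_near. Qed.

Lemma has_ubound_mdist f g :
  has_ubound (range (fun x => mdist (f x) (g x))).
Proof.
have : compact ((fun x => mdist (f x) (g x) : R^o) @` [set: K]).
  apply: continuous_compact => //; apply: continuous_subspaceT.
  exact: continuous_mdist.
move=> /compact_bounded[M [_ hM]]; exists (M + 1) => _ [x _ <-].
by rewrite (le_trans (ler_norm _))// hM ?ltrDl//; exists x.
Qed.

Lemma sup_dist_ub f g x :
  mdist (f x) (g x) <= sup_dist f g.
Proof. by apply: ub_le_sup; [exact: has_ubound_mdist|exists x]. Qed.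

Lemma sup_dist_ge0 f g : 0 <= sup_dist f g.
Proof.
have [e|/set0P[_ [x _ _]]] := eqVneq (range (fun x => mdist (f x) (g x))) set0.
  by rewrite /sup_dist e sup0.
by rewrite (le_trans (mdist_ge0 (f x) (g x)))// sup_dist_ub.
Qed.

Lemma sup_dist_le f g (e : R) : 0 <= e ->
  (forall x, mdist (f x) (g x) <= e) -> sup_dist f g <= e.
Proof.
move=> e0 fge; rewrite /sup_dist.
have [->|/set0P ne] := eqVneq (range (fun x => mdist (f x) (g x))) set0.
  by rewrite sup0.
by apply: ge_sup => // _ [x _ <-].
Qed.

HB.instance Definition _ := Choice.copy (cfun Y cK) (continuousType K Y).

Let sup_distxx (f : cfun Y cK) : sup_dist f f = 0.
Proof.
apply/eqP; rewrite eq_le sup_dist_ge0 andbT; apply: sup_dist_le => // x.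
by rewrite mdistxx.
Qed.

Let sup_dist_positivity (f g : cfun Y cK) : sup_dist f g = 0 -> f = g.
Proof.
move=> fg; apply/continuousEP => x; apply: mdist_positivity.
by apply/eqP; rewrite eq_le mdist_ge0 andbT -fg sup_dist_ub.
Qed.

Let sup_dist_sym (f g : cfun Y cK) : sup_dist f g = sup_dist g f.
Proof.
rewrite /sup_dist.
suff -> : (fun x => mdist (f x) (g x)) = (fun x => mdist (g x) (f x)) by [].
by apply/funext => x; exact: metric_sym.
Qed.

Let sup_dist_triangle (g f h : cfun Y cK) :
  sup_dist f h <= sup_dist f g + sup_dist g h.
Proof.
apply: sup_dist_le => [|x]; first by rewrite addr_ge0// sup_dist_ge0.
by rewrite (le_trans (metric_triangle _ (g x) _))// lerD// sup_dist_ub.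
Qed.

HB.instance Definition _ := isMetric.Build R (cfun Y cK)
  sup_distxx sup_dist_positivity sup_dist_sym sup_dist_triangle.

Lemma cfun_mdistE (f g : cfun Y cK) : mdist f g = sup_dist f g.
Proof. by []. Qed.

End Metric.

Section Complete.
Context {Y : completeMetricType R} {cK : compact [set: K]}.

HB.instance Definition _ :=
  isPointed.Build (cfun Y cK) (cst point : continuousType K Y).

Let cfun_complete (F : set_system (cfun Y cK)) :
  ProperFilter F -> cauchy F -> cvg F.
Proof.
move=> FF /cauchy_ballP Fc.
pose ev (x : K) (f : cfun Y cK) : Y := f x.
have cev x : cvg (ev x @ F).
  apply/cauchy_cvgP/cauchy_ballP => e e0.
  rewrite near_map2.
  apply: filterS (Fc _ e0) => -[f g] /=; rewrite !ballEmdist /= cfun_mdistE => fg.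
  by rewrite (le_lt_trans _ fg)// sup_dist_ub.
pose l x := lim (ev x @ F).
have unif e : 0 < e -> \forall f \near F, forall x, mdist (ev x f) (l x) <= e.
  move=> e0; have e2 : 0 < e / 2 by rewrite divr_gt0.
  have Fd : \forall f \near F, \forall g \near F, ball f (e / 2) g.
    exact: nearP_dep (Fc _ e2).
  apply: filterS Fd => f Ff x.
  have gl : \forall g \near F, ball (l x) (e / 2) (ev x g).
    by move/cvg_ballP : (cev x); exact.
  near F => g.
  have : ball (l x) (e / 2) (ev x g) by near: g; exact: gl.
  have : ball f (e / 2) g by near: g; exact: Ff.
  rewrite !ballEmdist/= cfun_mdistE => fg lg.
  rewrite (le_trans (metric_triangle _ (ev x g) _))//.
  rewrite [leRHS]splitr lerD//; last by rewrite metric_sym ltW.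
  by rewrite (le_trans (sup_dist_ub _ f g x))// ltW.
have cl : continuous l.
  move=> x; apply/cvg_ballP => e e0.
  have e3 : 0 < e / 3 by rewrite divr_gt0.
  near F => f.
  have fl : forall x, mdist (ev x f) (l x) <= e / 3 by near: f; exact: unif.
  have /cvg_ballP/(_ _ e3) fx := @cts_fun _ _ (f : continuousType K Y) x.
  near=> t.
  have : ball (ev x f) (e / 3) (ev t f) by near: t; exact: fx.
  rewrite !ballEmdist/= => ft.
  have := metric_triangle (l x) (ev x f) (l t).
  have := metric_triangle (ev x f) (ev t f) (l t).
  have := fl x; have := fl t; rewrite (metric_sym (ev x f) (l x)).
  by move=> *; lra.
apply/cvg_ex; exists (mkcts cl : continuousType K Y).
apply/cvg_ballP => e e0; rewrite near_simpl.
have e2 : 0 < e / 2 by rewrite divr_gt0.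
apply: filterS (unif _ e2) => f fl; rewrite ballEmdist/= metric_sym cfun_mdistE.
rewrite (@le_lt_trans _ _ (e / 2))//; last by rewrite ltr_pdivrMr// ltr_pMr// ltr1n.
exact/sup_dist_le/fl/ltW.
Unshelve. all: by end_near. Qed.

HB.instance Definition _ := Uniform_isComplete.Build (cfun Y cK) cfun_complete.

End Complete.
End SupMetric.

Section Schmidt.
Context {R : realType} {Y : completeMetricType R}.
Implicit Types (alpha beta : R) (x : nat -> Y) (S : set Y).

Definition game_radius alpha beta (r0 : R) n : R := (alpha * beta) ^+ n * r0.

(* From [r0] and Bob's centres [:: x_0; ...; x_n] so far, a strategy gives
   Alice's next centre y_(n+1); her own past moves are determined by these. *)
Definition strategy : Type := R -> seq Y -> Y.

(* y_(n+1) *)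
Definition alice_move (sigma : strategy) (r0 : R) x n : Y :=
  sigma r0 (mkseq x n.+1).

Definition alice_legal alpha beta sigma (r0 : R) x n : Prop :=
  let r := game_radius alpha beta r0 n in
  mdist (x n) (alice_move sigma r0 x n) + alpha * r <= r.

Definition bob_legal alpha beta sigma (r0 : R) x n : Prop :=
  let r := game_radius alpha beta r0 n in
  mdist (alice_move sigma r0 x n) (x n.+1) + alpha * beta * r <= alpha * r.

(* [z] lies in every ball B_n, equivalently in every A_n when the play is
   legal. *)
Definition outcome alpha beta (r0 : R) x (z : Y) : Prop :=
  forall n, mdist (x n) z <= game_radius alpha beta r0 n.

Definition winning_strategy alpha beta S (sigma : strategy) : Prop :=
  forall (r0 : R) x, 0 < r0 ->
    (forall n, (forall k, (k < n)%N -> bob_legal alpha beta sigma r0 x k) ->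
       alice_legal alpha beta sigma r0 x n) /\
    ((forall n, bob_legal alpha beta sigma r0 x n) ->
       exists2 z, outcome alpha beta r0 x z & S z).

Definition alpha_beta_winning alpha beta S : Prop :=
  exists sigma, winning_strategy alpha beta S sigma.

Definition alpha_winning alpha S : Prop :=
  forall beta, 0 < beta < 1 -> alpha_beta_winning alpha beta S.

Definition winning S : Prop :=
  exists2 alpha, 0 < alpha < 1 & alpha_winning alpha S.

End Schmidt.

Section Dimensions.
Context {R : realType} {X : metricType R}.
Implicit Types (E : set X) (C : set (set X)) (r s : R).
Local Open Scope ereal_scope.

(* Adjoining 0 only affects the empty set, which gets diameter 0. *)
Definition diam E : \bar R :=
  ereal_sup (0 |` [set (mdist p.1 p.2)%:E | p in E `*` E]).

Definition rcover r E C : Prop :=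
  E `<=` \bigcup_(U in C) U /\ (forall U, C U -> diam U <= r%:E).

Definition hausdorff_content r s E : \bar R :=
  ereal_inf [set \esum_(U in C) (diam U `^ s) |
             C in [set C | rcover r E C /\ countable C]].

(* Here 0 `^ 0 = 1. Covers are sets of sets, so a finite or empty cover needs
   no padding by empty sets, and the measure for s = 0 is the counting
   measure. *)
Definition hausdorff_measure s E : \bar R :=
  lim (hausdorff_content r s E @[r --> (0:R)^'+]).

Definition hausdorff_dim E : \bar R :=
  ereal_inf [set s%:E | s in [set s | (0 <= s)%R /\ hausdorff_measure s E = 0]].

Definition covering_number r E : \bar R :=
  ereal_inf [set n%:R%:E | n in
    [set n : nat | exists C : set (set X),
       [/\ (C #= `I_n)%card, (forall U, C U -> open U) & rcover r E C]]].

(* The library's [closed_ball] is the closure of the open ball, which may be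
   smaller in a general metric space. *)
Definition mball (x : X) r : set X := [set y | (mdist x y <= r)%R].

Definition assouad_bound E s : Prop :=
  exists2 c : R, (0 < c)%R & forall (r r' : R) (x : X),
    (0 < r < r')%R -> E x ->
    covering_number r (mball x r' `&` E) <= (c * powR (r' / r) s)%:E.

Definition assouad_dim E : \bar R :=
  ereal_inf [set s%:E | s in [set s | (0 <= s)%R /\ assouad_bound E s]].

End Dimensions.

Section TopologicalDimension.
Context {R : realType}.
Variable K : metricType R.

Definition topdim_le (n : nat) : Prop :=
  forall r : R, 0 < r -> exists C : set (set K),
    [/\ rcover r [set: K] C,
        (forall U, C U -> open U) &
        (forall x, [set U | C U /\ U x] #<= `I_n.+1)%card].

(* A minimum of integers, or +oo if there are none. *)
Definition topdim : \bar R := ereal_inf [set n%:R%:E | n in topdim_le].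

End TopologicalDimension.

(* Main.v *)
(* Covering dimension enters only through the following criterion: [K] has
   dimension less than [n] iff every continuous map [K -> R^n] can be perturbed
   arbitrarily little so as to avoid [0].  For one direction, values at the
   vertices of the nerve of a fine cover are put in general position; for the
   other, the faces with [n + 1] vertices of the nerve of a cover by balls are
   emptied one after the other.

   (i), (iv): if the criterion fails for [n <= d], it fails on small balls of
   [K], where Bob's first map is nearly constant;
     adding a rescaled essential map
   there, Alice makes the first [n] coordinates of all later maps cover a cube.

   (ii): if the criterion holds for [d], then Alice can push the image out of
   all cubes of radius comparable to [r_n] around the points of a lattice, at
   every stage; the image of the outcome is porous at all scales, and its
   covering numbers are those of a self-similar set made of [M ^ d - 1] pieces
     of
   ratio [1 / M].

   (iii): among condensation points of [K] Alice grows a binary tree, separating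
   at stage [n] the values at the two children of every node by a multiple of
   [r_n], so that the image of the outcome contains a Cantor set of positive
   dimension. *)

From HB Require Import structures.
Require Import Defs.
From mathcomp Require Import all_boot all_order all_algebra.
From mathcomp Require Import all_classical all_reals all_analysis.
From mathcomp Require Import ring lra zify.

Set Implicit Arguments.
Unset Strict Implicit.
Unset Printing Implicit Defensive.

Import Order.TTheory GRing.Theory Num.Theory.
Import numFieldNormedType.Exports.

Local Open Scope classical_set_scope.
Local Open Scope ring_scope.

(** * Continuous functions on a compact metric space *)

Section CompactMetric.
Context {R : realType} {K : metricType R}.
Implicit Types (A : set K) (f g : K -> R).

Lemma cts_ball f x e : continuous f -> 0 < e ->
  exists2 r, 0 < r & forall y, mdist x y < r -> `|f y - f x| < e.
Proof.
move=> cf e0; have /cvgrPdist_lt/(_ _ e0) := cf x.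
move=> /nbhs_ballP[r /= r0 xr]; exists r => // y xy.
by rewrite distrC; apply: xr; rewrite ballEmdist.
Qed.

Lemma ball_cts f :
  (forall x e, 0 < e ->
    exists2 r, 0 < r & forall y, mdist x y < r -> `|f y - f x| < e) ->
  continuous f.
Proof.
move=> cf x; apply/cvgrPdist_lt => e e0; have [r r0 xr] := cf x _ e0.
apply/nbhs_ballP; exists r => //= y; rewrite ballEmdist/= => xy.
by rewrite distrC; exact: xr.
Qed.

Lemma cts_ball_fam n (f : 'I_n -> K -> R) x e : (forall i, continuous (f i)) ->
  0 < e ->
  exists2 r, 0 < r & forall y, mdist x y < r -> forall i, `|f i y - f i x| < e.
Proof.
move=> cf e0.
have : \forall y \near x, forall i, `|f i x - f i y| < e.
  by apply: filter_forall => i; move/cvgrPdist_lt : (cf i x); exact.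
move=> /nbhs_ballP[r /= r0 xr]; exists r => // y xy i.
by rewrite distrC; apply: xr; rewrite ballEmdist.
Qed.

Lemma seq_min_pos (T : eqType) (s : seq T) (e : T -> R) :
  {in s, forall x, 0 < e x} -> exists2 m, 0 < m & {in s, forall x, m <= e x}.
Proof.
elim: s => [_|a s ih es]; first by exists 1.
have [x xs|m m0 ms] := ih; first by apply: es; rewrite inE xs orbT.
exists (Num.min m (e a)); first by rewrite lt_min m0 es// mem_head.
move=> x; rewrite inE => /predU1P[->|/ms mx]; first by rewrite ge_min lexx orbT.
by rewrite ge_min mx.
Qed.

Lemma open_mball_lt (x : K) (e : R) : open [set y | mdist x y < e].
Proof.
rewrite openE => y /= xy; rewrite /interior; apply/nbhs_ballP.
exists (e - mdist x y) => /=; first by rewrite subr_gt0.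
move=> z; rewrite ballEmdist/= => yz.
by have := metric_triangle x y z; lra.
Qed.

Lemma compact_ball_cover A (e : K -> R) : compact A ->
  (forall x, A x -> 0 < e x) ->
  exists2 s : seq K, (forall y, y \in s -> A y) &
    forall x, A x -> exists2 y, y \in s & mdist y x < e y.
Proof.
move=> cA e0; have [->|/set0P[x0 _]] := eqVneq A set0; first by exists [::].
(* The point [x0] of [A] makes [K] a pointed space, as [compact_cover] expects. *)
pose Kp : ptopologicalType := HB.pack (K : Type) K (isPointed.Build K x0).
have [D DA AD] : finite_subset_cover A (fun x => [set y | mdist x y < e x]) A.
  move: cA; rewrite -[X in X -> _]/(@compact Kp A) compact_cover.
  move=> /(_ K A); apply.
    by move=> x _; exact: open_mball_lt.
  by move=> x Ax; exists x => //=; rewrite mdistxx e0.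
exists (finmap.enum_fset D) => [y yD|x /AD[y /= yD xy]]; last by exists y.
by have := DA y yD; rewrite inE.
Qed.

(** Stands in for the extreme value theorem: a margin that holds near every point holds globally, as
    the minimum over a finite subcover. *)
Lemma compact_uniformly A (P : R -> K -> Prop) : compact A ->
  (forall m m' x, m' <= m -> P m x -> P m' x) ->
  (forall x, A x -> exists e m, [/\ 0 < e, 0 < m &
     forall y, mdist x y < e -> P m y]) ->
  exists2 m, 0 < m & forall x, A x -> P m x.
Proof.
move=> cA Pm AP.
have /choice[em emP] x : exists em : R * R, A x -> [/\ 0 < em.1, 0 < em.2 &
    forall y, mdist x y < em.1 -> P em.2 y].
  have [/AP[e [m ?]]|nA] := pselect (A x); first by exists (e, m).
  by exists (0, 0) => /nA.
have [|s sA As] := @compact_ball_cover A (fun x => (em x).1) cA.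
  by move=> x /emP[].
have [|m m0 ms] := @seq_min_pos _ s (fun x => (em x).2).
  by move=> x /sA/emP[].
exists m => // x /As[y ys yx].
by apply: Pm (ms _ ys) _; have [_ _] := emP y (sA _ ys); exact.
Qed.

Lemma unif_cts n (f : 'I_n -> K -> R) e : compact [set: K] ->
  (forall i, continuous (f i)) -> 0 < e ->
  exists2 r, 0 < r &
    forall x y, mdist x y < r -> forall i, `|f i y - f i x| < e.
Proof.
move=> cK cf e0.
have [||m m0 Pm] := @compact_uniformly [set: K] (fun r x =>
   forall y, mdist x y < r -> forall i, `|f i y - f i x| < e) cK.
- by move=> m m' x mm' Pm y xy i; apply: Pm; exact: lt_le_trans mm'.
- move=> x _; have e2 : 0 < e / 2 by rewrite divr_gt0.
  have [r r0 xr] := cts_ball_fam x cf e2.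
  exists (r / 2), (r / 2); split; rewrite ?divr_gt0// => y xy z yz i.
  have := metric_triangle x y z => xyz.
  rewrite (_ : f i z - f i y = (f i z - f i x) - (f i y - f i x)); last by ring.
  rewrite (le_lt_trans (ler_normB _ _))// [ltRHS]splitr ltrD// xr//; lra.
- by exists m => // x y; exact: Pm.
Qed.

Lemma cst_cts (c : R) : continuous (fun _ : K => c).
Proof. by move=> x; exact: cvg_cst. Qed.

Lemma add_cts f g : continuous f -> continuous g ->
  continuous (fun x => f x + g x).
Proof. by move=> cf cg x; apply: cvgD; [exact: cf|exact: cg]. Qed.

Lemma sub_cts f g : continuous f -> continuous g ->
  continuous (fun x => f x - g x).
Proof. by move=> cf cg x; apply: cvgB; [exact: cf|exact: cg]. Qed.

Lemma mul_cts f g : continuous f -> continuous g ->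
  continuous (fun x => f x * g x).
Proof. by move=> cf cg x; apply: cvgM; [exact: cf|exact: cg]. Qed.

Lemma norm_cts f : continuous f -> continuous (fun x => `|f x|).
Proof. by move=> cf x; apply: cvg_norm; exact: cf. Qed.

Lemma sum_cts (I : Type) (s : seq I) (f : I -> K -> R) :
  (forall i, continuous (f i)) -> continuous (fun x => \sum_(i <- s) f i x).
Proof.
move=> cf; elim: s => [|i s ih].
  by under eq_fun do rewrite big_nil; exact: cst_cts.
under eq_fun do rewrite big_cons.
exact: add_cts.
Qed.

Lemma prod_cts (I : Type) (s : seq I) (f : I -> K -> R) :
  (forall i, continuous (f i)) -> continuous (fun x => \prod_(i <- s) f i x).
Proof.
move=> cf; elim: s => [|i s ih].
  by under eq_fun do rewrite big_nil; exact: cst_cts.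
under eq_fun do rewrite big_cons.
exact: mul_cts.
Qed.

Lemma max_cts f g : continuous f -> continuous g ->
  continuous (fun x => Num.max (f x) (g x)).
Proof. by move=> cf cg x; by apply: continuous_max; [exact: cf|exact: cg]. Qed.

Lemma min_cts f g : continuous f -> continuous g ->
  continuous (fun x => Num.min (f x) (g x)).
Proof. by move=> cf cg x; by apply: continuous_min; [exact: cf|exact: cg]. Qed.

Lemma mdist_cts (p : K) : continuous (fun x => mdist p x : R).
Proof.
apply: ball_cts => x e e0; exists e => // y xy; rewrite ltr_norml.
have := metric_triangle p x y; have := metric_triangle p y x.
by rewrite (metric_sym y x) => *; apply/andP; split; lra.
Qed.

Definition clip (m t : R) : R := Num.max (- m) (Num.min m t).

Lemma clip_cts m f : continuous f -> continuous (fun x => clip m (f x)).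
Proof.
by move=> cf; apply: max_cts; [|apply: min_cts => //]; exact: cst_cts.
Qed.

Lemma clip_le m t : 0 <= m -> `|clip m t| <= m.
Proof.
move=> m0; rewrite /clip ler_norml le_max lexx/= ge_max ge_min lexx/= andbT.
by lra.
Qed.

Lemma clip_id m t : `|t| <= m -> clip m t = t.
Proof.
by rewrite ler_norml => /andP[mt tm]; rewrite /clip min_r// max_r.
Qed.

End CompactMetric.

(** * Covering dimension and maps that can be moved off the origin *)

Section Escapable.
Context {R : realType} {K : metricType R}.
Implicit Types (A : set K).

(** The perturbation criterion. Maps and perturbations live on all of [K] even when only [A] must
    avoid 0, so that a map inescapable on a small ball can be added to Bob's map. *)
Definition escapable n A : Prop :=
  forall (f : 'I_n -> K -> R) (e : R), (forall i, continuous (f i)) -> 0 < e ->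
  exists2 g : 'I_n -> K -> R, (forall i, continuous (g i)) &
    (forall i x, `|g i x - f i x| <= e) /\
    (forall x, A x -> exists i, g i x != 0).

Lemma avoid_margin n A (g : 'I_n -> K -> R) (p : 'I_n -> R) : compact A ->
  (forall i, continuous (g i)) -> (forall x, A x -> exists i, g i x != p i) ->
  exists2 m, 0 < m & forall x, A x -> exists i, m <= `|g i x - p i|.
Proof.
move=> cA cg gp; apply: (compact_uniformly cA) => [m m' x mm' [i pi]|x Ax].
  by exists i; exact: le_trans pi.
have [i gi] := gp x Ax.
have e0 : 0 < `|g i x - p i| / 2 by rewrite divr_gt0// normr_gt0 subr_eq0.
have [r r0 xr] := cts_ball x (cg i) e0.
exists r, (`|g i x - p i| / 2); split => // y /xr; exists i.
have := ler_distD (g i y) (g i x) (p i).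
by rewrite (distrC (g i x) (g i y)); lra.
Qed.

(** The pairs are treated one after the other. Each new perturbation is at most half the margin [m]
    reached so far, so earlier targets remain avoided. *)
Lemma escape_seq (J : eqType) n (s : seq J) (A : J -> set K)
    (p : J -> 'I_n -> R) (f : 'I_n -> K -> R) e :
  {in s, forall j, compact (A j) /\ escapable n (A j)} ->
  (forall i, continuous (f i)) -> 0 < e ->
  exists2 g : 'I_n -> K -> R, (forall i, continuous (g i)) &
    (forall i x, `|g i x - f i x| <= e) /\
    exists2 m, 0 < m &
      {in s, forall j x, A j x -> exists i, m <= `|g i x - p j i|}.
Proof.
move=> + cf; elim: s e => [|j s ih] e As e0.
  exists f => //; split=> [i x|]; first by rewrite subrr normr0 ltW.
  by exists 1.
have [| |g cg [gf [m m0 gm]]] := ih (e / 2); last 1 first.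
- have [cj ej] := As j (mem_head _ _).
  have e20 : 0 < Num.min (e / 2) (m / 2) by rewrite lt_min !divr_gt0.
  have [|h ch [hg hA]] := ej (fun i x => g i x - p j i) _ _ e20.
    by move=> i; apply: sub_cts; [exact: cg|exact: cst_cts].
  have ch' i : continuous (fun x => h i x + p j i).
    by apply: add_cts; [exact: ch|exact: cst_cts].
  exists (fun i x => h i x + p j i) => //.
  have hg' i x : `|h i x + p j i - g i x| <= Num.min (e / 2) (m / 2).
    by rewrite (_ : _ - _ = h i x - (g i x - p j i)) ?hg//; ring.
  split=> [i x|].
    have := hg' i x; rewrite le_min => /andP[h1 _].
    have := ler_distD (g i x) (h i x + p j i) (f i x); have := gf i x.
    by lra.
  have [|m' m'0 m'A] := avoid_margin (p := p j) cj ch'.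
    by move=> x /hA[i hi]; exists i; rewrite -subr_eq0 addrK.
  exists (Num.min m' (m / 2)); first by rewrite lt_min m'0 divr_gt0.
  move=> k; rewrite inE => /predU1P[->|ks] x Ax.
    by have [i mi] := m'A x Ax; exists i; rewrite ge_min mi.
  have [i mi] := gm k ks x Ax; exists i; rewrite ge_min; apply/orP; right.
  have := hg' i x; rewrite le_min => /andP[_ h1].
  have := ler_distD (h i x + p j i) (g i x) (p k i).
  by rewrite (distrC (g i x) (_ + _)); lra.
- by move=> k ks; apply: As; rewrite inE ks orbT.
- by rewrite divr_gt0.
Qed.

(* Truncating an essential map at the size of the perturbations it resists
   keeps it essential: adding the same perturbation to the untruncated map
   yields the same zeros. *)
Lemma essential_map n A : ~ escapable n A ->
  exists2 h : 'I_n -> K -> R, (forall i, continuous (h i)) &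
    (forall i x, `|h i x| <= 1) /\
    forall g : 'I_n -> K -> R, (forall i, continuous (g i)) ->
      (forall x, A x -> forall i, `|g i x - h i x| <= 2^-1) ->
      exists2 x, A x & forall i, g i x = 0.
Proof.
move=> /existsNP[f /existsNP[e /not_implyP[cf /not_implyP[e0 nesc]]]].
have e0' := ltW e0; have en0 : e != 0 by rewrite gt_eqF.
have ch i : continuous (fun x => clip e (f i x) / e).
  by apply: mul_cts; [exact: clip_cts|exact: cst_cts].
exists (fun i x => clip e (f i x) / e) => //; split=> [i x|g cg gA].
  by rewrite normrM normfV (gtr0_norm e0) ler_pdivrMr// mul1r clip_le.
pose g' i x := f i x + clip (e / 2) (e * g i x - clip e (f i x)).
have cg' i : continuous (g' i).
  apply: add_cts => //; apply: clip_cts; apply: sub_cts; last exact: clip_cts.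
  by apply: mul_cts => //; exact: cst_cts.
have [x Ax g0] : exists2 x, A x & forall i, g' i x = 0.
  apply: contrapT => /forall2NP nx; apply: nesc; exists g' => //; split.
    move=> i x; rewrite /g' addrC addKr (le_trans (clip_le _ _))//; lra.
  move=> x Ax; have [//|] := nx x.
  by move=> /existsNP[i /eqP gi]; exists i.
exists x => // i; have := g0 i; rewrite /g'.
have gAi := gA x Ax i.
have -> : clip (e / 2) (e * g i x - clip e (f i x)) =
    e * g i x - clip e (f i x).
  apply: clip_id.
  rewrite (_ : _ - _ = e * (g i x - clip e (f i x) / e)); last by field.
  by rewrite normrM (gtr0_norm e0) ler_wpM2l.
move=> /eqP; rewrite addr_eq0 => /eqP fE.
(* At a zero of [g'], [f i x] is minus the perturbation, hence of size at most [e], where the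
   truncation has no effect. *)
have fle : `|f i x| <= e.
  rewrite fE normrN.
  rewrite (_ : _ - _ = e * (g i x - clip e (f i x) / e)); last by field.
  by rewrite normrM (gtr0_norm e0) -[leRHS]mulr1 ler_wpM2l//; lra.
move: fE; rewrite clip_id// => fE.
have /eqP : e * g i x = 0 by lra.
by rewrite mulf_eq0 (negbTE en0) => /eqP.
Qed.

Lemma diam_le (E : set K) (r : R) : 0 <= r ->
  (forall x y, E x -> E y -> mdist x y <= r) -> (diam E <= r%:E)%E.
Proof.
move=> r0 Er; apply: ge_ereal_sup => _ [->|[[x y] /= [Ex Ey] <-]].
  by rewrite lee_fin.
by rewrite lee_fin Er.
Qed.

End Escapable.

(** * From the perturbation criterion to fine covers of small order *)

Section CoveringDimension.
Context {R : realType} {K : metricType R} (cK : compact [set: K]).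

Lemma bigmin_cts (I : Type) (s : seq I) (f0 : K -> R) (f : I -> K -> R) :
  continuous f0 -> (forall i, continuous (f i)) ->
  continuous (fun x => \big[Num.min/f0 x]_(i <- s) f i x).
Proof.
move=> c0 cf; elim: s => [|i s ih].
  by under eq_fun do rewrite big_nil.
under eq_fun do rewrite big_cons.
exact: min_cts.
Qed.

(** A partition of unity without normalisation; the sets where the functions are positive form the
    cover whose nerve is simplified. *)
Definition partition_like N (psi : 'I_N -> K -> R) : Prop :=
  [/\ forall i, continuous (psi i), forall i x, 0 <= psi i x &
      forall x, exists i, 0 < psi i x].

(* Making the [n + 2] functions indexed by [s] nowhere simultaneously equal and
   then subtracting their minimum empties the face [s] of the nerve, while some
   function of the family stays positive everywhere. *)
Lemma empty_face n N (psi : 'I_N -> K -> R) (s : 'I_n.+2 -> 'I_N) :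
  escapable n.+1 [set: K] -> injective s -> partition_like psi ->
  exists2 psi' : 'I_N -> K -> R, partition_like psi' &
    (forall i x, 0 < psi' i x -> 0 < psi i x) /\
    (forall x, exists k, psi' (s k) x = 0).
Proof.
move=> esc sinj [cpsi psi0 psipos].
have [m m0 psim] : exists2 m, 0 < m & forall x, setT x -> exists i, m <= psi i
  x.
  apply: (compact_uniformly cK) => [m m' x mm' [i pi]|x _].
    by exists i; exact: le_trans pi.
  have [i pi] := psipos x; have pi2 : 0 < psi i x / 2 by rewrite divr_gt0.
  have [r r0 xr] := cts_ball x (cpsi i) pi2.
  exists r, (psi i x / 2); split => // y /xr; rewrite ltr_norml => /andP[? ?].
  by exists i; lra.
(* Some [psi i x] is always at least [m]. Lowering [G], which is [e]-close to [psi], by [e] keeps it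
   below [psi], yet at least [m / 2] where [psi] is at least [m]. *)
pose e := m / 4; have e0 : 0 < e by rewrite divr_gt0.
have [|h ch [hpsi hn0]] :=
  esc (fun k x => psi (s (lift ord0 k)) x - psi (s ord0) x) e _ e0.
  by move=> i; apply: sub_cts.
(* The differences with the function indexed by [s ord0] form a map to [R^(n+1)], perturbed to [h].
   The values [G k x] are all equal exactly when [h] vanishes at [x], which never happens. *)
pose G (k : 'I_n.+2) x :=
  psi (s ord0) x + if unlift ord0 k is Some j then h j x else 0.
have cG k : continuous (G k).
  by apply: add_cts => //; case: unlift => [j|]; [exact: ch|exact: cst_cts].
have Gpsi k x : `|G k x - psi (s k) x| <= e.
  rewrite /G; case: unliftP => [j|] ->; last by rewrite addr0 subrr normr0 ltW.
  have := hpsi j x.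
  by rewrite (_ : h j x - _ = psi (s ord0) x + h j x - psi (s (lift ord0 j))
    x)//;
    ring.
have Gneq x : ~ exists c, forall k, G k x = c.
  move=> [c Gc]; have [j hj] := hn0 x I.
  have := Gc (lift ord0 j); rewrite -(Gc ord0) /G liftK unlift_none.
  by move=> /addrI hj0; rewrite hj0 eqxx in hj.
pose H k x := Num.max 0 (G k x - e).
have cH k : continuous (H k).
  apply: max_cts; first exact: cst_cts.
  by apply: sub_cts; [exact: cG|exact: cst_cts].
pose mu x := \big[Num.min/H ord0 x]_k H k x.
have cmu : continuous mu by exact: bigmin_cts.
have mu_le k x : mu x <= H k x by exact: bigmin_le.
have mu_eq x : exists k, mu x = H k x.
  apply: (big_ind (fun v => exists k, v = H k x)); first by exists ord0.
    by move=> _ _ [k ->] [l ->]; rewrite minEle; case: ifP; [exists k|exists l].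
  by move=> k _; exists k.
pose psi' i x := if [pick k | s k == i] is Some k then H k x - mu x else psi i
  x.
have psi's k x : psi' (s k) x = H k x - mu x.
  by rewrite /psi'; case: pickP => [l /eqP/sinj->//|/(_ k)]; rewrite eqxx.
have mu0 x : 0 <= mu x.
  by have [k ->] := mu_eq x; rewrite le_max lexx.
exists psi'; split => //.
- by move=> i; rewrite /psi'; case: pickP => [k _|_//]; exact: sub_cts.
- by move=> i x; rewrite /psi'; case: pickP => [k _|//]; rewrite subr_ge0.
- move=> x; have [i mi] := psim x I; apply: contrapT => /forallNP np.
  move: mi; case: (pickP (fun k => s k == i)) => [k /eqP <-{i}|nk] mi.
    (* If all new functions of the face vanish at [x], all [H l x] equal [mu x], which is positive
       by [mi]; then all [G l x] coincide, against [Gneq]. *)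
    have Hmu l : H l x = mu x.
      apply/eqP; rewrite eq_le mu_le andbT leNgt; apply/negP => lt.
      by apply: (np (s l)); rewrite psi's subr_gt0.
    have mupos : 0 < mu x.
      rewrite -(Hmu k) /H lt_max; apply/orP; right.
      have := Gpsi k x; rewrite ler_norml /e => /andP[]; move: mi m0; lra.
    apply: (Gneq x); exists (mu x + e) => l.
    have := Hmu l; rewrite /H maxEle; case: ifP => _ muE;
      first by rewrite -muE subrK.
    by rewrite -muE ltxx in mupos.
  apply: (np i); rewrite /psi'; case: pickP => [k|_]; first by rewrite nk.
  exact: lt_le_trans mi.
- move=> i x; rewrite /psi'; case: pickP => [k /eqP <-|//].
  move=> Hmu; have : 0 < H k x by apply: le_lt_trans (mu0 x) _;
    rewrite -subr_gt0.
  rewrite /H lt_max ltxx/=; have := Gpsi k x.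
  by rewrite ler_norml => /andP[]; lra.
- by move=> x; have [k muk] := mu_eq x; exists k; rewrite psi's muk subrr.
Qed.

(** Supports only shrink, so a face once emptied stays empty. *)
Lemma empty_faces n N (psi : 'I_N -> K -> R) (l : seq {ffun 'I_n.+2 -> 'I_N}) :
  escapable n.+1 [set: K] -> all (fun s : {ffun _ -> _} => injectiveb s) l ->
  partition_like psi ->
  exists2 psi' : 'I_N -> K -> R, partition_like psi' &
    (forall i x, 0 < psi' i x -> 0 < psi i x) /\
    (forall s, s \in l -> forall x, exists k, psi' (s k) x = 0).
Proof.
move=> esc + Ppsi; elim: l => [_|s l ih /= /andP[/injectiveP sinj /ih]].
  by exists psi.
move=> [psi1 P1 [psi1S psi1l]].
have [psi2 P2 [psi2S psi2s]] := empty_face esc sinj P1.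
exists psi2 => //; split=> [i x /psi2S/psi1S//|t].
rewrite inE => /predU1P[->|tl] x; first exact: psi2s.
have [k tk] := psi1l t tl x; exists k; apply/eqP; rewrite eq_le.
have [_ psi20 _] := P2; rewrite psi20 andbT leNgt.
by apply/negP => /psi2S; rewrite tk ltxx.
Qed.

Lemma escapable_topdim_le n : escapable n.+1 [set: K] -> topdim_le K n.
Proof.
move=> esc r r0; have r20 : 0 < r / 2 by rewrite divr_gt0.
have [//|s _ sK] := @compact_ball_cover _ _ _ (fun=> r / 2) cK.
pose N := size s; pose p (i : 'I_N) := tnth (in_tuple s) i.
pose phi (i : 'I_N) x := Num.max 0 (r / 2 - mdist (p i) x).
have phi_gt0 i x : (0 < phi i x) = (mdist (p i) x < r / 2).
  by rewrite lt_max ltxx subr_gt0.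
have Pphi : partition_like phi.
  split=> [i|i x|x].
  - apply: max_cts; first exact: cst_cts.
    by apply: sub_cts; [exact: cst_cts|exact: mdist_cts].
  - by rewrite le_max lexx.
  - have [//|y ys yx] := sK x.
    have iN : (index y s < N)%N by rewrite index_mem.
    exists (Ordinal iN).
    by rewrite phi_gt0 /p (tnth_nth y)/= nth_index.
pose l := [seq s : {ffun 'I_n.+2 -> 'I_N} <- enum {: {ffun 'I_n.+2 -> 'I_N}} |
  injectiveb s].
have [|psi [cpsi psi0 psipos] [psiphi psil]] := empty_faces (l := l) esc _ Pphi.
  exact: filter_all.
exists (range (fun i => [set x | 0 < psi i x])); split.
- split=> [x _|_ [i _ <-]].
    have [i ix] := psipos x.
    by exists [set x | 0 < psi i x]; [exists i|exact: ix].
  apply: diam_le => [|x y /= /psiphi + /psiphi]; first exact: ltW.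
  rewrite !phi_gt0 => xi yi; have := metric_triangle x (p i) y.
  by rewrite (metric_sym x (p i)); lra.
- move=> _ [i _ <-]; rewrite openE => x /= ix; rewrite /interior.
  apply/nbhs_ballP; have [e e0 xe] := cts_ball x (cpsi i) ix.
  exists e => // y; rewrite ballEmdist /= => /xe.
  by rewrite ltr_norml => /andP[]; lra.
- move=> x; pose P := [set i | 0 < psi i x]%SET.
  have Ple : (#|P| <= n.+1)%N.
    rewrite leqNgt; apply/negP => Pn.
    (* If [n + 2] functions were positive at [x], their indices would form a face listed in [l], and
       those are empty. *)
    pose t := [ffun k => enum_val (widen_ord Pn k)].
    have tinj : injective t.
      by move=> j k; rewrite !ffunE => /enum_val_inj/(congr1 val)/= /val_inj.
    have tl : t \in l.
      by rewrite mem_filter mem_enum inE andbT; apply/injectiveP.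
    have [k] := psil t tl x; rewrite ffunE => tk0.
    by have := enum_valP (widen_ord Pn k); rewrite inE tk0 ltxx.
  have [P0|/card_gt0P[i0 _]] := posnP #|P|.
    rewrite (_ : [set U | _] = set0) ?card_ge0//.
    rewrite -subset0 => _ [[i _ <-]] /= ix.
    by have := card0_eq P0 i; rewrite !inE ix.
  apply: (@card_le_trans _ _ _ `I_(#|P|)); last by rewrite card_le_II.
  apply: (card_le_trans _ (card_image_le
    (fun k => [set x | 0 < psi (nth i0 (enum P) k) x]) _)).
  apply: subset_card_le => _ [[i _ <-]] /= ix.
  have iP : i \in enum P by rewrite mem_enum inE.
  exists (index i (enum P)); first by rewrite /= cardE index_mem.
  by rewrite nth_index.
Qed.

End CoveringDimension.

(** * Vectors in general position *)

Section GeneralPosition.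
Context {R : realType}.

(** [P] has fewer than [size P] roots, so one of the numbers [S0 + k] with [k < size P] is not a
    root. *)
Lemma poly_large_nonroot (P : {poly R}) (S0 : R) : P != 0 ->
  exists2 s, S0 <= s & P.[s] != 0.
Proof.
move=> P0; pose rs := [seq S0 + k%:R | k <- iota 0 (size P)].
apply: contrapT => ns.
have : all (root P) rs.
  apply/allP => _ /mapP[k _ ->]; rewrite /root; apply/negPn/negP => Pk.
  by apply: ns; exists (S0 + k%:R) => //; rewrite lerDl.
have urs : uniq rs.
  rewrite map_inj_uniq ?iota_uniq// => a b /addrI/eqP.
  by rewrite eqr_nat => /eqP.
by move=> /(max_poly_roots P0)/(_ urs); rewrite size_map size_iota ltnn.
Qed.

(* [s * v] is the evaluation at [s] of a matrix over polynomials whose value at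
   [0] is a Vandermonde matrix, so its minors vanish for finitely many [s]. *)
Lemma general_position d M (f : 'I_M -> 'I_d -> R) (e : R) : 0 < e ->
  exists2 v : 'I_M -> 'I_d -> R, (forall k i, `|v k i - f k i| <= e) &
    forall t : 'I_d -> 'I_M, injective t ->
      \det (\matrix_(a < d, b < d) v (t a) b) != 0.
Proof.
move=> e0.
pose A (t : 'I_d -> 'I_M) : 'M[{poly R}]_d :=
  \matrix_(a < d, b < d) (f (t a) b *: 'X + ((t a)%:R ^+ b)%:P).
pose P := \prod_(t : {ffun 'I_d -> 'I_M} | injectiveb t) \det (A t).
have hA (t : 'I_d -> 'I_M) s : (\det (A t)).[s] =
    \det (\matrix_(a < d, b < d) (f (t a) b * s + (t a)%:R ^+ b)).
  rewrite -[LHS]/(horner_eval s _) -det_map_mx; congr (\det _).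
  by apply/matrixP => a b; rewrite !mxE /= /horner_eval !hornerE.
have P0 : P != 0.
  apply/prodf_neq0 => t /injectiveP tinj; apply/negP => /eqP A0.
  have := hA t 0; rewrite A0 horner0.
  pose a : 'rV[R]_d := \row_j (t j)%:R.
  have -> : (\matrix_(a < d, b < d) (f (t a) b * 0 + (t a)%:R ^+ b)) =
      (Vandermonde d a)^T.
    by apply/matrixP => i j; rewrite !mxE mulr0 add0r.
  rewrite det_tr det_Vandermonde => /esym/eqP; apply/negP.
  apply/prodf_neq0 => i _; apply/prodf_neq0 => j ij;
    rewrite !mxE subr_eq0 eqr_nat.
  by apply: contraTN ij => /eqP/val_inj/tinj ->; rewrite ltnn.
(* The vectors are moved by [k ^ i / s] with [k < M] and [i < d], hence by at most [M ^ d / s],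
   which is below [e] for [s] beyond [S0]. *)
pose S0 : R := (M ^ d)%:R / e + 1.
have [s sS Ps] := poly_large_nonroot S0 P0.
have MdS : (M ^ d)%:R / e < s by rewrite (lt_le_trans _ sS)// /S0 ltrDl.
have s0 : 0 < s by rewrite (le_lt_trans _ MdS)// divr_ge0// ltW.
exists (fun k i => f k i + k%:R ^+ i / s) => [k i|t tinj].
  rewrite addrC addKr normrM normfV (gtr0_norm s0) ler_pdivrMr// ger0_norm//.
  rewrite (@le_trans _ _ (M ^ d)%:R)//.
    rewrite natrX (@le_trans _ _ (M%:R ^+ i))//.
      by rewrite lerXn2r ?nnegrE// ler_nat ltnW.
    by rewrite ler_weXn2l ?ler1n ?(leq_ltn_trans _ (ltn_ord k))// ltnW.
  by rewrite -ler_pdivrMl// mulrC ltW.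
move: Ps; rewrite /P horner_prod => /prodf_neq0/(_ [ffun a => t a]).
have tE : [ffun a => t a] =1 t by move=> a; rewrite ffunE.
have -> : injectiveb [ffun a => t a] by apply/injectiveP => a b;
  rewrite !tE => /tinj.
move=> /(_ isT); rewrite hA; apply: contraNneq => det0.
rewrite (_ : (\matrix_(_, _) _) = s *: \matrix_(a, b) (f (t a) b + (t a)%:R ^+
  b / s)).
  by rewrite detZ det0 mulr0.
by apply/matrixP => a b; rewrite !mxE tE; field; rewrite gt_eqF.
Qed.

(** The at most [d] indices with nonzero coefficient extend to [d] distinct ones, and the vectors
    there are linearly independent. *)
Lemma general_comb d M (v : 'I_M -> 'I_d -> R) (c : 'I_M -> R) : (d <= M)%N ->
  (forall t : 'I_d -> 'I_M, injective t ->
      \det (\matrix_(a < d, b < d) v (t a) b) != 0) ->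
  (#|[set k | c k != 0%R]%SET| <= d)%N -> (exists k, c k != 0) ->
  exists i, \sum_k c k * v k i != 0.
Proof.
move=> dM vgen cd [k0 ck0]; pose T := [set k | c k != 0%R]%SET.
pose l := enum T ++ enum (~: T)%SET.
have sl : size l = M by rewrite size_cat -!cardE cardsC card_ord.
have ul : uniq l.
  rewrite cat_uniq !enum_uniq andbT/=; apply/hasPn => k.
  by rewrite !mem_enum !inE => /negbTE ->.
pose t (a : 'I_d) := nth k0 l a.
have tinj : injective t.
  move=> a b /eqP; rewrite nth_uniq ?sl ?(leq_trans (ltn_ord _))//.
  by move=> /eqP/val_inj.
have tT k : c k != 0 -> exists a, t a = k.
  move=> ck; have kT : k \in enum T by rewrite mem_enum inE.
  have kd : (index k (enum T) < d)%N.
    by rewrite (leq_trans _ cd)// cardE index_mem.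
  by exists (Ordinal kd); rewrite /t /l nth_cat index_mem kT nth_index.
apply: contrapT => /forallNP g0.
have := vgen _ tinj; set V := \matrix_(_, _) _ => Vu.
have Vunit : V \in unitmx by rewrite unitmxE unitfE.
pose r : 'rV[R]_d := \row_a c (t a).
have rV : r *m V = 0.
  apply/rowP => i; rewrite !mxE; have /negP/negPn/eqP gi := g0 i;
    rewrite -[RHS]gi.
  rewrite [RHS](bigID (fun k => k \in t @: finset.setT))/= [X in _ + X]big1
    ?addr0.
    rewrite big_imset/=; last by move=> ? ? _ _ /tinj.
    by apply: eq_big => a; rewrite ?inE// !mxE.
  move=> k kt; have [->|/tT[a ak]] := eqVneq (c k) 0; first by rewrite mul0r.
  by case/negP: kt; rewrite -ak imset_f.
have r0 : r = 0 by rewrite -[r](mulmxK Vunit) rV mul0mx.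
have [a ak] := tT _ ck0; move: ck0; rewrite -ak.
by have /rowP/(_ a) := r0; rewrite !mxE => ->; rewrite eqxx.
Qed.

End GeneralPosition.

(** * From covering dimension to the perturbation criterion *)

Section TopdimEscapable.
Context {R : realType} {K : metricType R} (cK : compact [set: K]).

Lemma inv_cts (f : K -> R) : continuous f -> (forall x, f x != 0) ->
  continuous (fun x => (f x)^-1).
Proof. by move=> cf f0 x; apply: cvgV => //; exact: cf. Qed.

Lemma mdist_le_diam (E : set K) (r : R) x y : (diam E <= r%:E)%E ->
  E x -> E y -> mdist x y <= r.
Proof.
move=> Er Ex Ey; rewrite -lee_fin (le_trans _ Er)//.
by apply: ereal_sup_ubound; right; exists (x, y).
Qed.

(** The new map sends [x] to a weighted mean of vectors in general position near the values of [f].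
    At most [n + 1] vectors carry weight at [x], one for each set of the cover containing [x], so
    the mean is not 0. *)
Lemma topdim_le_escapable n : topdim_le K n -> escapable n.+1 [set: K].
Proof.
move=> dimK f e cf e0.
have e20 : 0 < e / 2 by rewrite divr_gt0.
have [dlt dlt0 fdlt] := unif_cts cK cf e20.
have [|C [[KC Cd] Co Cn]] := dimK (dlt / 2); first by rewrite divr_gt0.
have /choice[U UP] x : exists Ue : set K * R, [/\ C Ue.1, 0 < Ue.2 &
    forall y, mdist x y < Ue.2 -> Ue.1 y].
  have [//|V CV Vx] := KC x; have : nbhs x V by apply: open_nbhs_nbhs;
    split=> //; exact: Co.
  move=> /nbhs_ballP[r /= r0 rV]; exists (V, r); split => // y xy.
  by apply: rV; rewrite ballEmdist.
have [|s _ sK] := @compact_ball_cover _ _ _ (fun x => (U x).2) cK.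
  by move=> x _; have [] := UP x.
(* The [n + 1] additional vectors ensure [n + 1 <= M], as [general_comb] requires. *)
pose N := size s; pose M := (N + n.+1)%N.
pose p (j : 'I_N) := tnth (in_tuple s) j.
pose u (k : nat) := (nth set0 [seq (U x).1 | x <- s] k).
have uE (j : 'I_N) : u j = (U (p j)).1.
  by rewrite /u (nth_map (p j))// [in RHS]/p (tnth_nth (p j)).
have rho_lt (j : 'I_N) : (index (u j) [seq (U x).1 | x <- s] < N)%N.
  by rewrite -[ltnRHS](size_map (fun x => (U x).1)) index_mem mem_nth//
    size_map.
(* Several balls may lie in the same set of [C]. Sending [j] to the first index with the same set
   gives one vertex for each member of [C], so that the order of [C] bounds the number of weighted
   vertices. *)
pose rho j : 'I_N := Ordinal (rho_lt j).
have urho j : u (rho j) = u j by rewrite /u nth_index// mem_nth// size_map.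
have rho_inj j k : u (rho j) = u (rho k) -> rho j = rho k.
  by rewrite !urho => jk; apply: val_inj; rewrite /= jk.
pose lam (j : 'I_N) x := Num.max 0 ((U (p j)).2 - mdist (p j) x).
have clam j : continuous (lam j).
  apply: max_cts; first exact: cst_cts.
  by apply: sub_cts; [exact: cst_cts|exact: mdist_cts].
have lam0 j x : 0 <= lam j x by rewrite le_max lexx.
have lam_gt0 j x : 0 < lam j x -> u j x.
  by rewrite lt_max ltxx subr_gt0 uE /= => pjx; have [_ _ h] := UP (p j);
    exact: h.
pose L x := \sum_j lam j x.
have L0 x : 0 < L x.
  have [//|y ys yx] := sK x.
  have jN : (index y s < N)%N by rewrite index_mem.
  rewrite /L (bigD1 (Ordinal jN))//= ltr_pwDl ?sumr_ge0//.
  by rewrite lt_max subr_gt0 /p (tnth_nth y)/= nth_index// yx orbT.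
pose w j x := lam j x / L x.
have cw j : continuous (w j).
  apply: mul_cts => //; apply: inv_cts; first exact: sum_cts.
  by move=> x; rewrite gt_eqF.
have w0 j x : 0 <= w j x by rewrite divr_ge0// ltW.
have w1 x : \sum_j w j x = 1 by rewrite /w -mulr_suml -/(L x) divff// gt_eqF.
have wu j x : w j x != 0 -> u j x.
  move=> wj; apply: lam_gt0; rewrite lt_def lam0 andbT.
  by apply: contraNneq wj; rewrite /w => ->; rewrite mul0r.
pose rhoM j : 'I_M := widen_ord (leq_addr n.+1 N) (rho j).
have [K0|/existsNP[x0 _]] := pselect (forall x : K, False).
  by exists f => //; split=> [i x|x]; have := K0 x.
have [v vf vgen] := general_position
  (fun (k : 'I_M) i => f i (nth x0 s k)) e20.
exists (fun i x => \sum_j w j x * v (rhoM j) i).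
  by move=> i; apply: sum_cts => j; apply: mul_cts => //; exact: cst_cts.
split=> [i x|x _].
  rewrite -[f i x]mul1r -(w1 x) mulr_suml -sumrB.
  rewrite (le_trans (ler_norm_sum _ _ _))//.
  rewrite -[leRHS]mul1r -(w1 x) mulr_suml ler_sum// => j _.
  rewrite -mulrBr normrM ger0_norm//.
  have [->|wj] := eqVneq (w j x) 0; first by rewrite !mul0r.
  rewrite ler_wpM2l//; have := vf (rhoM j) i => /= vfi.
  rewrite (le_trans (ler_distD (f i (nth x0 s (rho j))) _ _))//.
  rewrite [leRHS]splitr lerD// ltW// fdlt//.
  have uj := wu _ _ wj; have [Cj _ uc] := UP (p (rho j)).
  have := Cd _ Cj; rewrite -uE => djl.
  rewrite (@le_lt_trans _ _ (dlt / 2))//; last by lra.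
  apply: (mdist_le_diam djl); first by rewrite urho.
  rewrite uE (_ : nth _ _ _ = p (rho j)); last by rewrite /p (tnth_nth x0).
  by apply: uc; rewrite mdistxx; have [] := UP (p (rho j)).
pose c (k : 'I_M) := \sum_(j | rhoM j == k) w j x.
have cE i : \sum_j w j x * v (rhoM j) i = \sum_k c k * v k i.
  rewrite (partition_big rhoM xpredT)//=; apply: eq_bigr => k _.
  by rewrite mulr_suml; apply: eq_bigr => j /eqP ->.
have cN k : c k != 0 -> exists2 j, rhoM j = k & u j x.
  move=> ck; apply: contrapT => /forall2NP nk.
  move: ck; rewrite /c big1 ?eqxx// => j /eqP jk.
  by have [//|] := nk j; apply: contra_notP => /eqP; exact: wu.
have [| |i gi] := general_comb (c := c) (leq_addl _ _) vgen.
- pose T := [set k | c k != 0%R]%SET.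
  have [->//|/card_gt0P[k0 _]] := posnP #|T|; pose t a := nth k0 (enum T) a.
  rewrite -[(_ <= _)%N]card_le_II.
  have tT a : (a < #|T|)%N -> c (t a) != 0.
    move=> aT; have : t a \in enum T by rewrite mem_nth// -cardE.
    by rewrite mem_enum inE.
  have tinj : {in `I_#|T| &, injective (fun a => u (t a))}.
    move=> a b; rewrite !inE /= => aT bT ab.
    have [j ja _] := cN _ (tT _ aT); have [k kb _] := cN _ (tT _ bT).
    have tab : t a = t b.
      by move: ab; rewrite -ja -kb => /rho_inj jk; rewrite /rhoM jk.
    apply/eqP; rewrite -(nth_uniq k0 _ _ (enum_uniq T)) -?cardE//.
    exact/eqP.
  rewrite -(card_le_eql (inj_card_eq tinj)).
  apply: card_le_trans (Cn x); apply: subset_card_le => _ [a /= aT <-].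
  have [j ja ujx] := cN _ (tT _ aT); rewrite -ja /= urho; split=> //.
  by rewrite uE; have [] := UP (p j).
- apply: contrapT => /forallNP c0; have := w1 x.
  have -> : \sum_j w j x = \sum_k c k.
    by rewrite (partition_big rhoM xpredT).
  rewrite big1 => [/esym/eqP|k _]; first by rewrite oner_eq0.
  by apply/eqP/negPn/negP/c0.
- by exists i; rewrite cE.
Qed.

End TopdimEscapable.

(** * Strategies in Schmidt's game *)

Section Game.
Context {R : realType} {Y : completeMetricType R}.
Implicit Types (alpha beta : R) (S : set Y).

Lemma winningS S S' : S `<=` S' -> winning S -> winning S'.
Proof.
move=> SS' [a a01 aS]; exists a => // b b01; have [s sS] := aS b b01.
exists s => r0 x r00; have [h1 h2] := sS r0 x r00; split=> // /h2[z zx Sz].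
by exists z => //; exact: SS'.
Qed.

(** Both rules together give [mdist (x n) (x n.+1) <= r n - r n.+1]. This telescopes, so Bob's
    centres are Cauchy and the limit lies in every ball. *)
Lemma legal_outcome alpha beta (sigma : strategy) r0 (x : nat -> Y) :
  0 < alpha < 1 -> 0 < beta < 1 -> 0 < r0 ->
  (forall n, alice_legal alpha beta sigma r0 x n) ->
  (forall n, bob_legal alpha beta sigma r0 x n) ->
  exists z, outcome alpha beta r0 x z.
Proof.
move=> /andP[a0 a1] /andP[b0 b1] r00 al bl.
pose r := game_radius alpha beta r0.
have ab0 : 0 < alpha * beta by rewrite mulr_gt0.
have ab1 : alpha * beta < 1 by rewrite mulr_ilt1// ltW.
have r0' n : 0 < r n by rewrite mulr_gt0// exprn_gt0.
have rS n : r n.+1 = alpha * beta * r n by rewrite /r /game_radius exprS mulrA.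
have xS n : mdist (x n) (x n.+1) <= r n - r n.+1.
  have := al n; have := bl n; rewrite /alice_legal /bob_legal -/(r n) rS /=.
  have := metric_triangle (x n) (alice_move sigma r0 x n) (x n.+1).
  lra.
have xD n k : mdist (x n) (x (n + k)%N) <= r n - r (n + k)%N.
  elim: k => [|k ih]; first by rewrite addn0 mdistxx subrr.
  have := xS (n + k)%N; rewrite addnS => xk.
  by have := metric_triangle (x n) (x (n + k)%N) (x (n + k).+1); lra.
have r_cvg : r @ \oo --> (0 : R).
  have -> : r = geometric r0 (alpha * beta).
    by apply/funext => n; rewrite /r /game_radius /geometric/= mulrC.
  by apply: cvg_geometric; rewrite gtr0_norm.
have cx : cauchy (x @ \oo).
  apply/cauchy_ballP => e e0; rewrite near_map2.
  have e2 : 0 < e / 2 by rewrite divr_gt0.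
  have /cvgrPdist_lt/(_ _ e2)[N _ Nr] := r_cvg.
  exists ([set n | N <= n]%N, [set n | N <= n]%N).
    by split; exists N.
  move=> [n m] /= [Nn Nm]; rewrite ballEmdist/=.
  have := Nr N (leqnn N); rewrite /= sub0r normrN gtr0_norm// => rN.
  have := xD N (n - N)%N; have := xD N (m - N)%N; rewrite !subnKC//.
  have := metric_triangle (x n) (x N) (x m); rewrite (metric_sym (x n) (x N)).
  by have := r0' n; have := r0' m; lra.
have /cauchy_cvgP/cvg_ballP xz := cx.
exists (lim (x @ \oo)) => n; rewrite -/(r n); apply/ler_addgt0Pr => e e0.
have [N _ Nx] := xz e e0.
have := Nx (n + N)%N; rewrite /= leq_addl => /(_ isT).
rewrite ballEmdist/= metric_sym => xnN.
have := metric_triangle (x n) (x (n + N)%N) (lim (x @ \oo)).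
by have := xD n N; have := r0' (n + N)%N; lra.
Qed.

(* Alice remembers an element of [T] satisfying the invariant [Inv], and [rel]
   records what each of her moves achieves. *)
Lemma state_winning alpha beta S (T : Type) (t0 : T) (Inv : nat -> T -> Prop)
    (rel : R -> nat -> Y -> T -> T -> Y -> Prop) :
  0 < alpha < 1 -> 0 < beta < 1 -> Inv 0%N t0 ->
  (forall r0 n x t, 0 < r0 -> Inv n t ->
    let r := game_radius alpha beta r0 n in
    exists t' y, [/\ Inv n.+1 t', rel r0 n x t t' y &
      mdist x y + alpha * r <= r]) ->
  (forall r0 x y t z, 0 < r0 -> (forall n, Inv n (t n)) ->
    (forall n, rel r0 n (x n) (t n) (t n.+1) (y n)) ->
    (forall n, mdist (y n) z <= alpha * game_radius alpha beta r0 n) -> S z) ->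
  alpha_beta_winning alpha beta S.
Proof.
move=> a01 b01 I0 step win.
have /choice[F FP] (q : R * nat * Y * T) : exists q' : T * Y,
    let: (r0, n, x, t) := q in let r := game_radius alpha beta r0 n in
    0 < r0 -> Inv n t -> [/\ Inv n.+1 q'.1, rel r0 n x t q'.1 q'.2 &
      mdist x q'.2 + alpha * r <= r].
  case: q => [[[r0 n] x] t].
  have [h|h] := pselect (0 < r0 /\ Inv n t); last first.
    by exists (t, x) => r h1 h2; case: h.
  by have [t' [y ?]] := step r0 n x t h.1 h.2; exists (t', y).
pose G r0 (a : nat * T * Y) x := (a.1.1.+1, F (r0, a.1.1, x, a.1.2)).
(* A strategy sees only Bob's moves, so Alice's state is recomputed by folding the chosen step [F]
   over them. *)
pose acc r0 s := foldl (fun a x => let: (n, (t, y)) := G r0 a x in (n, t, y))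
  (0%N, t0, point) s.
pose sigma r0 s := (acc r0 s).2.
exists sigma => r0 x r00.
pose st n := (acc r0 (mkseq x n)).1.2.
have accS n : acc r0 (mkseq x n.+1) =
    (n.+1, (F (r0, n, x n, st n)).1, (F (r0, n, x n, st n)).2).
  elim: n => [|n ih]; first by rewrite /acc /= /G/=; case: (F _).
  rewrite mkseqS /acc foldl_rcons -/(acc r0 _) /st ih /G/=.
  by case: (F _).
have stI n : Inv n (st n).
  elim: n => [//|n ih]; rewrite /st accS /=.
  by have [] := FP (r0, n, x n, st n) r00 ih.
have FPn n := FP (r0, n, x n, st n) r00 (stI n).
have moveE n : alice_move sigma r0 x n = (F (r0, n, x n, st n)).2.
  by rewrite /alice_move /sigma accS.
have al n : alice_legal alpha beta sigma r0 x n.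
  by rewrite /alice_legal moveE; have [] := FPn n.
split=> [n _ //|bl].
have [z zx] := legal_outcome a01 b01 r00 al bl.
exists z => //; apply: (win r0 x (fun n => (F (r0, n, x n, st n)).2) st) => //
  n.
  by rewrite {2}/st accS; have [] := FPn n.
(* The outcome lies in Bob's ball [n.+1], which is contained in Alice's ball of stage [n]. *)
have := bl n; have := zx n.+1; rewrite /bob_legal moveE /= /game_radius exprS.
set y := (F _).2; have := metric_triangle y (x n.+1) z.
by rewrite -!mulrA; lra.
Qed.

(** The first move settles the game; afterwards Alice repeats Bob's centre. *)
Lemma one_move_winning alpha S : 0 < alpha < 1 ->
  (forall x r, 0 < r -> exists2 y, mdist x y + alpha * r <= r &
     forall z, mdist y z <= alpha * r -> S z) ->
  winning S.
Proof.
move=> a01 mv; exists alpha => // b b01.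
have /andP[a0 a1] := a01; have /andP[b0 b1] := b01.
apply: (@state_winning _ _ _ unit tt (fun _ _ => True) (fun r0 n x _ _ y =>
  n = 0%N -> forall z, mdist y z <= alpha * r0 -> S z)) => //.
- move=> r0 [|n] x [] r00 _; exists tt.
    have [y xy yS] := mv x r0 r00; exists y.
    by split; rewrite // /game_radius expr0 mul1r.
  exists x; split=> //; rewrite mdistxx add0r.
  by rewrite ger_pMl ?ltW// mulr_gt0// exprn_gt0// mulr_gt0.
- move=> r0 x y t z r00 _ /(_ 0%N erefl) h /(_ 0%N).
  by rewrite /game_radius expr0 mul1r; exact: h.
Qed.

End Game.

(** * Coordinates of maps into Euclidean space *)

Section Coordinates.
Context {R : realType} {K : metricType R} (cK : compact [set: K]) (d : nat).
Notation F := (cfun (euclidean R d) cK).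
Implicit Types f g : F.

Definition ecoord (v : euclidean R d) (i : 'I_d) : R := (v : 'rV[R]_d) ord0 i.

Lemma ecoord_le (v w : euclidean R d) i :
  `|ecoord v i - ecoord w i| <= mdist v w.
Proof.
have := eucl_norm_coord ((v : 'rV[R]_d) - (w : 'rV[R]_d)) i.
by rewrite !mxE.
Qed.

Lemma mdist_le_sum (v w : euclidean R d) :
  mdist v w <= \sum_i `|ecoord v i - ecoord w i|.
Proof.
rewrite eucl_mdistE (le_trans (eucl_norm_le_sum _))//.
by apply: ler_sum => i _; rewrite !mxE.
Qed.

Lemma mdist_le_coord (v w : euclidean R d) e :
  (forall i, `|ecoord v i - ecoord w i| <= e) -> mdist v w <= d%:R * e.
Proof.
move=> vw; rewrite (le_trans (mdist_le_sum _ _))//.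
rewrite (le_trans (ler_sum _ (fun i _ => vw i)))//.
by rewrite sumr_const card_ord mulr_natl.
Qed.

Lemma ecoord_cts f i : continuous (fun x => ecoord (f x) i).
Proof.
apply: ball_cts => x e e0.
have /cvg_ballP/(_ _ e0) := @cts_fun _ _ (f : continuousType K _) x.
move=> /nbhs_ballP[r /= r0 xr]; exists r => // y xy.
rewrite (le_lt_trans (ecoord_le _ _ _))// metric_sym.
by have := xr y; rewrite !ballEmdist/=; exact.
Qed.

Lemma cfun_of_coords (g : 'I_d -> K -> R) : (forall i, continuous (g i)) ->
  exists f, forall x i, ecoord (f x) i = g i x.
Proof.
move=> cg; pose h x : euclidean R d := (\row_i g i x : 'rV[R]_d).
have ch : continuous h.
  move=> x; apply/cvg_ballP => e e0.
  have e1 : 0 < e / d.+1%:R by rewrite divr_gt0.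
  have [r r0 xr] := cts_ball_fam x cg e1.
  apply/nbhs_ballP; exists r => //= y; rewrite !ballEmdist/= => xy.
  rewrite metric_sym.
  apply: (@le_lt_trans _ _ (d%:R * (e / d.+1%:R))).
    by apply: mdist_le_coord => i; rewrite /ecoord !mxE ltW// xr.
  by rewrite mulrCA gtr_pMr// ltr_pdivrMr// mul1r ltr_nat.
by exists (mkcts ch : continuousType K _) => x i; rewrite /ecoord mxE.
Qed.

Lemma cfun_mdist_le f g e : 0 <= e ->
  (forall x, \sum_i `|ecoord (f x) i - ecoord (g x) i| <= e) -> mdist f g <= e.
Proof.
move=> e0 fg; rewrite cfun_mdistE; apply: sup_dist_le => // x.
exact: le_trans (mdist_le_sum _ _) _.
Qed.

Lemma cfun_mdist_le_coord f g e : 0 <= e ->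
  (forall x i, `|ecoord (f x) i - ecoord (g x) i| <= e) ->
  mdist f g <= d%:R * e.
Proof.
move=> e0 fg; apply: cfun_mdist_le => [|x]; first by rewrite mulr_ge0.
rewrite (le_trans (ler_sum _ (fun i _ => fg x i)))//.
by rewrite sumr_const card_ord mulr_natl.
Qed.

Lemma cfun_ecoord_le f g x i : `|ecoord (f x) i - ecoord (g x) i| <= mdist f g.
Proof.
rewrite (le_trans (ecoord_le _ _ _))// cfun_mdistE.
exact: (sup_dist_ub cK f g x).
Qed.

End Coordinates.

(** * Images with interior points *)

Section EssentialMove.
Context {R : realType} {K : metricType R} (cK : compact [set: K]).
Context (d : nat).
Notation F := (cfun (euclidean R d) cK).

Lemma mball_compact (p : K) r : compact (mball p r).
Proof.
apply: (subclosed_compact _ cK) => //.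
rewrite -[mball p r]setCK closedC; rewrite openE => y /= /negP.
rewrite -ltNge /interior => py; apply/nbhs_ballP.
exists (mdist p y - r) => /=; first by rewrite subr_gt0.
move=> z; rewrite ballEmdist/= => yz; apply/negP; rewrite -ltNge.
by have := metric_triangle p z y; rewrite (metric_sym z y); lra.
Qed.

(** Finitely many balls of radius [e] cover [K]; if all of them were escapable, [escape_seq] would
    treat them together. *)
Lemma small_inescapable n e : 0 < e -> ~ @escapable R K n [set: K] ->
  exists p, ~ @escapable R K n (mball p e).
Proof.
move=> e0 ne; apply: contrapT => /forallNP esc; apply: ne => f e' cf e'0.
have [//|s _ sK] := @compact_ball_cover _ _ _ (fun=> e) cK.
have [|g cg [gf [m m0 gm]]] := @escape_seq _ _ _ n s (fun p => mball p e)
  (fun _ _ => 0) f e' _ cf e'0.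
  by move=> p _; split; [exact: mball_compact|exact: contrapT].
exists g => //; split => // x _; have [//|p ps px] := sK x.
have [|i mi] := gm p ps x; first exact: ltW.
by exists i; rewrite -normr_gt0 (lt_le_trans m0)//; move: mi; rewrite subr0.
Qed.

Definition fills_cube n (nd : (n <= d)%N) (f : F) : Prop :=
  exists (v0 : 'I_n -> R) (l : R), 0 < l /\
    forall v : 'I_n -> R, (forall i, `|v i - v0 i| <= l) ->
    exists x, forall i, ecoord (f x) (widen_ord nd i) = v i.

Lemma fills_cube_winning n (nd : (n <= d)%N) : (0 < d)%N ->
  ~ @escapable R K n [set: K] -> winning [set f : F | fills_cube nd f].
Proof.
move=> d0 ness; have dR0 : 0 < (d%:R : R) by rewrite ltr0n.
have dR1 : 1 <= (d%:R : R) by rewrite ler1n.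
(* Small enough for [art] below: the drift [alpha * r] of the outcome plus a shift of the target by
   [alpha * r] stay within the tolerance [t / 2] of the map [t * h]. *)
pose alpha : R := (16 * d%:R)^-1.
have alphaE : alpha * d%:R = 1 / 16 by rewrite /alpha; field; rewrite gt_eqF.
have a0 : 0 < alpha by rewrite invr_gt0 mulr_gt0.
have a1 : alpha <= 1 / 16 by nra.
apply: (@one_move_winning _ _ alpha) => [|f0 r r0].
  by rewrite a0; lra.
(* Changing each coordinate by at most [2 * t] uses exactly Alice's allowance [(1 - alpha) * r]. *)
pose t := (1 - alpha) * r / (2 * d%:R).
have tE : d%:R * (2 * t) = (1 - alpha) * r.
  by rewrite /t; field; rewrite gt_eqF.
have t0 : 0 < t by rewrite divr_gt0 ?mulr_gt0//; lra.
have art : 2 * (alpha * r) <= t * 2^-1.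
  rewrite -(ler_pM2l dR0).
  have -> : d%:R * (2 * (alpha * r)) = 2 * (alpha * d%:R) * r by ring.
  by rewrite alphaE; nra.
have [e e0 fe] := unif_cts cK (ecoord_cts (f := f0)) t0.
have [|p np] := small_inescapable (e := e / 2) _ ness;
  first by rewrite divr_gt0.
have [h ch [h1 hess]] := essential_map np.
pose c i := ecoord (f0 p) i.
(* On the ball around [p], [f0] is [t]-close to [f0 p], so the truncation is inactive and [y] equals
   [c + t * h]; elsewhere it limits the move. Coordinates from [n] on are unchanged. *)
pose y (i : 'I_d) x := if insub (i : nat) is Some k
  then ecoord (f0 x) i + clip (2 * t) (c i + t * h k x - ecoord (f0 x) i)
  else ecoord (f0 x) i.
have cy i : continuous (y i).
  rewrite /y; case: insub => [k|]; last exact: ecoord_cts.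
  apply: add_cts; first exact: ecoord_cts.
  apply: clip_cts; apply: sub_cts; last exact: ecoord_cts.
  by apply: add_cts; [|apply: mul_cts => //]; exact: cst_cts.
have [f1 f1E] := cfun_of_coords cK cy.
exists f1.
  have : mdist f0 f1 <= d%:R * (2 * t).
    apply: cfun_mdist_le_coord => [|x i]; first lra.
    rewrite f1E /y; case: insub => [k|]; last by rewrite subrr normr0; lra.
    by rewrite opprD addNKr normrN clip_le//; lra.
  by rewrite tE; lra.
move=> z zf1; exists (fun i => c (widen_ord nd i)), (alpha * r).
split; first by rewrite mulr_gt0.
move=> v vc.
have [| |x Ax gx] := hess (fun i x => (ecoord (z x) (widen_ord nd i) - v i) /
  t).
- move=> i; apply: mul_cts; last exact: cst_cts.
  by apply: sub_cts; [exact: ecoord_cts|exact: cst_cts].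
- move=> x Ax i.
  rewrite -(ler_pM2l t0) -[X in X * `|_|](gtr0_norm t0) -normrM.
  have : y (widen_ord nd i) x = c (widen_ord nd i) + t * h i x.
    have iE : insub (widen_ord nd i : nat) = Some i :> option 'I_n.
      exact: valK i.
    rewrite /y iE clip_id; first by rewrite addrC subrK.
    have pxe : mdist p x < e by rewrite (le_lt_trans Ax)//; lra.
    have := fe _ _ pxe (widen_ord nd i); rewrite -/(c _).
    have := h1 i x; rewrite !ler_norml ltr_norml => /andP[? ?] /andP[? ?].
    by apply/andP; split; nra.
  rewrite -f1E => yE.
  have := cfun_ecoord_le f1 z x (widen_ord nd i); rewrite yE => zy.
  have -> : t * ((ecoord (z x) (widen_ord nd i) - v i) / t - h i x) =
     ecoord (z x) (widen_ord nd i) - v i - t * h i x.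
    by field; rewrite gt_eqF.
  have := vc i; move: zy zf1 art.
  set zi := ecoord _ _; set ci := c _; set thi := t * _.
  move=> /le_trans /[apply] + art.
  rewrite !ler_norml => /andP[? ?] /andP[? ?].
  by apply/andP; split; lra.
- exists x => i; have /eqP := gx i.
  by rewrite mulf_eq0 invr_eq0 (gt_eqF t0) orbF subr_eq0 => /eqP.
Qed.

Lemma fills_cube_interior (f : F) :
  fills_cube (leqnn d) f -> interior (range f) !=set0.
Proof.
move=> [v0 [l [l0 fl]]].
exists ((\row_i v0 i : 'rV[R]_d) : euclidean R d); rewrite /interior.
apply/nbhs_ballP; exists l => //= w; rewrite ballEmdist/= => wl.
have [|x xE] := fl (fun i => ecoord w i).
  move=> i; rewrite distrC; move: (ecoord_le (\row_i v0 i : 'rV[R]_d) w i).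
  by rewrite /ecoord mxE => /le_trans; apply; exact: ltW.
exists x => //; apply/rowP => i.
have := xE i; rewrite /ecoord (_ : widen_ord _ i = i)//; exact: val_inj.
Qed.

End EssentialMove.

(** * Lower bounds for Hausdorff measure and dimension *)

Section HausdorffLowerBounds.
Context {R : realType} {X : metricType R}.
Implicit Types (E : set X) (r s t : R).

Lemma diam_ge0 E : (0 <= diam E)%E.
Proof. by apply: ereal_sup_ubound; left. Qed.

Lemma rcover_fin_diam r E (C : set (set X)) U : rcover r E C -> C U ->
  diam U = (fine (diam U))%:E.
Proof. by move=> [_ /[apply]]; have := diam_ge0 U; case: (diam U). Qed.

Lemma le_content r r' s E : r <= r' ->
  (hausdorff_content r' s E <= hausdorff_content r s E)%E.
Proof.
move=> rr'; apply: le_ereal_inf_tmp => _ [C [[EC Cr] cC] <-].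
apply: ereal_inf_lbound; exists C => //; split=> //; split=> // U /Cr.
by move=> /le_trans; apply; rewrite lee_fin.
Qed.

Lemma content_le_measure r s E : 0 < r ->
  (hausdorff_content r s E <= hausdorff_measure s E)%E.
Proof.
move=> r0; apply: lime_ge; last first.
  by near=> r'; apply: le_content; near: r'; exact: nbhs_right_le.
apply: nonincreasing_at_right_is_cvge; near=> r' => a b _ _.
exact: le_content.
Unshelve. all: by end_near. Qed.

(** At scale 1 all diameters are at most 1. Since [0 <= t < s], the exponent [s] is positive, so
    sets of diameter 0 contribute 0 on the left even if [t = 0]. *)
Lemma content_le_exponent s t E : 0 <= t -> t < s ->
  (hausdorff_content 1 s E <= hausdorff_content 1 t E)%E.
Proof.
move=> t0 ts; apply: le_ereal_inf_tmp => _ [C [EC cC] <-].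
apply: (@le_trans _ _ (\esum_(U in C) (diam U `^ s)%E)).
  by apply: ereal_inf_lbound; exists C.
apply: le_esum => U CU; have dU := rcover_fin_diam EC CU.
have := diam_ge0 U; have [_ /(_ _ CU)] := EC.
rewrite dU !poweR_EFin !lee_fin => U1.
rewrite le_eqVlt => /predU1P[<-|U0]; last by rewrite ger_powR ?U0// ltW.
by rewrite powR0 ?powR_ge0// gt_eqF// (le_lt_trans t0).
Qed.

Lemma hausdorff_dim_ge s c E : 0 < c ->
  (c%:E <= hausdorff_content 1 s E)%E -> (s%:E <= hausdorff_dim E)%E.
Proof.
move=> c0 cs; apply: le_ereal_inf_tmp => _ [t [t0 Ht0] <-].
rewrite lee_fin leNgt; apply/negP => ts.
have := le_trans cs (le_trans (content_le_exponent E t0 ts)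
  (content_le_measure t E ltr01)).
by rewrite Ht0 lee_fin leNgt c0.
Qed.

Lemma sum_half_pow (l : seq nat) : uniq l ->
  \sum_(k <- l) (2^-1 : R) ^+ k.+1 <= 1.
Proof.
move=> ul; pose m := (\max_(k <- l) k).+1.
have lm k : k \in l -> (k < m)%N by move=> kl; rewrite ltnS;
  exact: leq_bigmax_seq.
have -> : \sum_(k <- l) (2^-1 : R) ^+ k.+1 =
    \sum_(0 <= k < m | k \in l) (2^-1 : R) ^+ k.+1.
  rewrite -[RHS]big_filter; apply: perm_big; apply: uniq_perm => //.
    by rewrite filter_uniq// iota_uniq.
  by move=> k; rewrite mem_filter mem_index_iota /=;
    case: (boolP (k \in l)) => // /lm ->.
rewrite big_mkcond/= (@le_trans _ _ (\sum_(0 <= k < m) (2^-1 : R) ^+ k.+1))//.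
  by apply: ler_sum => k _; case: ifP => // _; rewrite exprn_ge0.
suff -> : \sum_(0 <= k < m) (2^-1 : R) ^+ k.+1 = 1 - 2^-1 ^+ m.
  by rewrite gerBl exprn_ge0.
elim: m {lm} => [|m ih]; first by rewrite big_geq// expr0 subrr.
by rewrite big_nat_recr//= ih exprS; lra.
Qed.

(** Gives the room to replace a covering set by an open neighbourhood at cost [tau]. *)
Lemma powR_enlarge (a s tau : R) : 0 < s -> 0 <= a -> 0 < tau ->
  exists2 e, 0 < e & (a + 2 * e) `^ s = a `^ s + tau.
Proof.
move=> s0 a0 tau0; pose b := (a `^ s + tau) `^ s^-1.
have sn0 : s != 0 by rewrite gt_eqF.
have as0 : 0 <= a `^ s by exact: powR_ge0.
have bE : b `^ s = a `^ s + tau.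
  by rewrite /b -powRrM mulVf// powRr1// addr_ge0// ltW.
have ab : a < b.
  rewrite ltNge; apply/negP => ba.
  have := ge0_ler_powR (ltW s0) _ _ ba; rewrite bE !nnegrE powR_ge0.
  by move=> /(_ isT a0); lra.
exists ((b - a) / 2); first by lra.
by rewrite (_ : a + _ = b)//; lra.
Qed.

(* Mass distribution principle; counting measures on finite subsets of [E] can
   play the role of the measure because [E] is compact. *)
Lemma content_ge E s c r : 0 < s -> 0 < c -> compact E ->
  (forall eta, 0 < eta -> exists (J : finType) (p : J -> X),
     [/\ (0 < #|J|)%N, (forall j, E (p j)) &
         forall (A : {set J}) dlt, eta <= dlt ->
         {in A &, forall i j, mdist (p i) (p j) <= dlt} ->
         #|A|%:R <= c * dlt `^ s * #|J|%:R]) ->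
  (c^-1%:E <= hausdorff_content r s E)%E.
Proof.
move=> s0 c0 cE mass; apply: le_ereal_inf_tmp => _ [C [EC /countable_injP[io
  ioC]] <-].
apply/lee_addgt0Pr => e e0.
pose D (U : set X) := fine (diam U).
have D0 U : 0 <= D U by rewrite fine_ge0// diam_ge0.
have DE U : C U -> diam U = (D U)%:E by exact: rcover_fin_diam EC.
(* The injection [io] numbers the cover, so the errors [tau U] of distinct sets add up to at most
   [e]. *)
pose tau U : R := e * 2^-1 ^+ (io U).+1.
have tau0 U : 0 < tau U by rewrite mulr_gt0// exprn_gt0.
have /choice[ep epP] U : exists e',
    0 < e' /\ (D U + 2 * e') `^ s = D U `^ s + tau U.
  by have [e' ? ?] := powR_enlarge s0 (D0 U) (tau0 U); exists e'.
have ep0 U : 0 < ep U by have [] := epP U.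
have epE U : (D U + 2 * ep U) `^ s = D U `^ s + tau U by have [] := epP U.
have [EsubC Cr] := EC.
have /choice[V VP] x : exists V, E x -> C V /\ V x.
  by have [/EsubC[V]|nE] := pselect (E x); [exists V|exists set0 => /nE].
have [x _|q qE Eq] := compact_ball_cover (e := fun x => ep (V x)) cE.
  exact: ep0.
(* Compactness leaves finitely many sets, whose [ep]-neighbourhoods cover [E]. Duplicates are
   removed so that the errors remain summable and the sum is bounded by the [esum]. *)
pose L := undup [seq V x | x <- q].
have LC U : U \in L -> C U.
  by rewrite mem_undup => /mapP[x xq ->]; have [] := VP x (qE _ xq).
(* With [eta] below all enlarged diameters, the hypothesis applies to the points near each set of
   [L]. *)
have [|eta eta0 etaL] := @seq_min_pos R _ L (fun U => D U + 2 * ep U).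
  by move=> U _; rewrite ltr_wpDl// mulr_gt0.
have [J [p [J0 pE pJ]]] := mass _ eta0.
pose A U := [set j | `[<exists2 x, U x & mdist x (p j) < ep U>]]%SET.
have inA U j : j \in A U <-> exists2 x, U x & mdist x (p j) < ep U.
  by split=> [|h]; rewrite inE; [move/asboolP|exact/asboolP].
have Ale U : U \in L -> #|A U|%:R <= c * (D U `^ s + tau U) * #|J|%:R.
  move=> UL; rewrite -epE; apply: pJ; first exact: etaL.
  move=> i j /inA[x Ux xi] /inA[y Uy yj].
  have : mdist x y <= D U.
    by apply: mdist_le_diam Ux Uy; rewrite DE//; exact: LC.
  have := metric_triangle (p i) x (p j); have := metric_triangle x y (p j).
  by rewrite (metric_sym (p i) x); lra.
have JA : (#|J|%:R : R) <= \sum_(U <- L) #|A U|%:R.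
  rewrite -natr_sum ler_nat -sum1_card.
  rewrite (eq_bigr (fun U => \sum_(j in A U) 1)%N); last first.
    by move=> U _; rewrite sum1_card.
  rewrite (exchange_big_dep xpredT)//=; apply: leq_sum => j _.
  have [x xq xj] := Eq _ (pE j).
  rewrite (big_rem (V x))/=; last by rewrite mem_undup map_f.
  have -> // : j \in A (V x) by apply/inA; exists x => //; have [] :=
    VP _ (qE _ xq).
have : 1 <= c * \sum_(U <- L) (D U `^ s + tau U).
  have JR : 0 < (#|J|%:R : R) by rewrite ltr0n.
  rewrite -(ler_pM2r JR) mul1r (le_trans JA)//.
  rewrite mulr_sumr mulr_suml big_seq [leRHS]big_seq.
  by apply: ler_sum => U /Ale.
rewrite -ler_pdivrMl// mulr1 => cL.
have tauL : \sum_(U <- L) tau U <= e.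
  rewrite -mulr_sumr -[leRHS]mulr1 ler_wpM2l ?(ltW e0)//.
  rewrite -(big_map io xpredT (fun k => 2^-1 ^+ k.+1)) sum_half_pow//.
  rewrite map_inj_in_uniq ?undup_uniq// => U W UL WL.
  by apply: ioC; rewrite inE; exact: LC.
have esumL : ((\sum_(U <- L) D U `^ s)%:E <= \esum_(U in C) (diam U `^ s))%E.
  apply: esum_ge; exists [set` L].
    by split=> [|U /LC//]; exact: finite_seq.
  rewrite -fsbig_seq ?undup_uniq// -sumEFin big_seq [in leRHS]big_seq.
  by apply: lee_sum => U /LC CU; rewrite DE.
apply: le_trans (leeD2r e%:E esumL); rewrite -EFinD lee_fin.
move: cL; rewrite big_split/= => /le_trans; apply.
by rewrite lerD2l.
Qed.

(** A cover of a nonempty set has a member, and its zeroth power is 1 even if its diameter is 0. *)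
Lemma content0_ge1 E r : E !=set0 -> (1 <= hausdorff_content r 0 E)%E.
Proof.
move=> [x Ex]; apply: le_ereal_inf_tmp => _ [C [EC _] <-].
have [/(_ _ Ex)[U CU _] _] := EC.
apply: esum_ge; exists [set U]; first by split=> // _ ->.
by rewrite fsbig_set1 poweRe0.
Qed.

End HausdorffLowerBounds.

(** * Hausdorff content of images that fill a cube *)

Section CubeMeasure.
Context {R : realType} {K : metricType R} (cK : compact [set: K]).
Context (d : nat).
Notation F := (cfun (euclidean R d) cK).

Lemma cfun_range_compact (f : F) : compact (range f).
Proof.
apply: continuous_compact => //; apply: continuous_subspaceT.
exact: (@cts_fun _ _ (f : continuousType K _)).
Qed.

(** Subtracting in each coordinate the minimum over [A] embeds [A] in a box with [D + 1] values per
    coordinate. *)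
Lemma card_ffun_box n m (A : {set {ffun 'I_n -> 'I_m}}) D :
  (forall phi psi i, phi \in A -> psi \in A -> (phi i <= psi i + D)%N) ->
  (#|A| <= D.+1 ^ n)%N.
Proof.
move=> AD; have [->|[phi0 phi0A]] := set_0Vmem A; first by rewrite cards0.
have [a aP] : exists a : 'I_n -> nat, forall i phi, phi \in A ->
    (a i <= phi i)%N /\ (phi i <= a i + D)%N.
  exists (fun i => ([arg min_(phi < phi0 in A) phi i] i : nat)) => i phi phiA.
  case: arg_minnP => // psi psiA /(_ _ phiA) le.
  by split=> //; exact: AD.
pose g (phi : {ffun 'I_n -> 'I_m}) : {ffun 'I_n -> 'I_D.+1} :=
  [ffun i => inord (phi i - a i)].
rewrite -(card_in_imset (f := g)).
  by rewrite (leq_trans (max_card _))// card_ffun !card_ord.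
move=> phi psi phiA psiA /ffunP gE; apply/ffunP => i; apply: val_inj => /=.
have := gE i; rewrite !ffunE => /(congr1 val)/=.
have [p1 p2] := aP i _ phiA; have [q1 q2] := aP i _ psiA.
rewrite !inordK ?ltnS ?leq_subLR// => pq.
by rewrite -(subnK p1) pq subnK.
Qed.

(** The mass distribution principle is applied to image points whose first [n] coordinates run
    through a grid of [m ^ n] points in the cube, with step [l / m <= eta]. *)
Lemma fills_cube_content n (nd : (n <= d)%N) (f : F) : (0 < n)%N ->
  fills_cube nd f ->
  exists2 c, 0 < c & forall r, (c%:E <= hausdorff_content r n%:R (range f))%E.
Proof.
move=> n0 [v0 [l [l0 fl]]].
have l0' := ltW l0.
have c0 : 0 < (2 / l) ^+ n by rewrite exprn_gt0// divr_gt0.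
exists ((2 / l) ^+ n)^-1 => [|r]; first by rewrite invr_gt0.
apply: content_ge => //; first by rewrite ltr0n.
  exact: cfun_range_compact.
move=> eta eta0; pose m := (Num.truncn (l / eta)).+1.
have m0 : 0 < (m%:R : R) by rewrite ltr0n.
have leta : l / m%:R <= eta.
  rewrite ler_pdivrMr// -ler_pdivrMl// mulrC ltW//.
  by rewrite /m truncnS_gt.
have /choice[x xE] (phi : {ffun 'I_n -> 'I_m}) : exists x, forall i,
    ecoord (f x) (widen_ord nd i) = v0 i + l / m%:R * (phi i)%:R.
  apply: fl => i; have lm0 : 0 <= l / m%:R by rewrite divr_ge0// ltW.
  rewrite addrC addKr ger0_norm ?mulr_ge0//.
  rewrite mulrAC ler_pdivrMr// ler_wpM2l//.
  by rewrite ler_nat ltnW.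
exists ({ffun 'I_n -> 'I_m} : finType), (fun phi => f (x phi)); split.
- by rewrite card_ffun !card_ord expn_gt0.
- by move=> phi; exists (x phi).
move=> A dlt etad Ad.
have dlt0 : 0 <= dlt by lra.
(* Since [dlt] is at least one grid step, the [D + 1] possible values per coordinate number at most
   [2 * dlt * m / l]; this gives the constant [(2 / l) ^ n]. *)
have q1 : 1 <= dlt * m%:R / l.
  by rewrite ler_pdivlMr// mul1r -ler_pdivrMr//; lra.
pose D := Num.truncn (dlt * m%:R / l).
have DA : (#|A| <= D.+1 ^ n)%N.
  apply: card_ffun_box => phi psi i phiA psiA.
  have := Ad _ _ phiA psiA; have :=
    ecoord_le (f (x phi)) (f (x psi)) (widen_ord nd i).
  move=> /le_trans/[apply]; rewrite !xE opprD addrACA subrr add0r -mulrBr.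
  move=> /(le_trans (ler_norm _)).
  move=> h; have {}h : (phi i)%:R - (psi i)%:R <= dlt * m%:R / l.
    rewrite ler_pdivlMr// -ler_pdivrMr//.
    by rewrite (_ : _ / _ = l / m%:R * ((phi i)%:R - (psi i)%:R))//; ring.
  rewrite -leq_subLR -(ler_nat R) /D.
  have [le|lt] := leqP (phi i) (psi i); first by rewrite (eqP le).
  rewrite ler_nat truncn_ge_nat; last by lra.
  by rewrite natrB 1?ltnW.
rewrite card_ffun !card_ord natrX powR_mulrn// -!exprMn.
rewrite (@le_trans _ _ ((D.+1 ^ n)%:R))// ?ler_nat// natrX.
rewrite lerXn2r// ?nnegrE ?mulr_ge0 ?invr_ge0//.
have : D%:R <= dlt * m%:R / l by rewrite truncn_le//; lra.
rewrite -[D.+1%:R]natr1 (_ : 2 / l * dlt * m%:R = dlt * m%:R / l * 2);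
  last by field; rewrite gt_eqF.
by lra.
Qed.

End CubeMeasure.

(** * Porous images and Assouad dimension *)

Section AvoidLattice.
Context {R : realType} {K : metricType R} (cK : compact [set: K]).

Lemma bigmax_cts (I : Type) (s : seq I) (f : I -> K -> R) :
  (forall i, continuous (f i)) ->
  continuous (fun x => \big[Num.max/0]_(i <- s) f i x).
Proof.
move=> cf; elim: s => [|i s ih].
  by under eq_fun do rewrite big_nil; exact: cst_cts.
under eq_fun do rewrite big_cons.
exact: max_cts.
Qed.

Lemma coords_bounded n (f : 'I_n -> K -> R) : (forall i, continuous (f i)) ->
  exists2 B, 0 < B & forall i x, `|f i x| <= B.
Proof.
move=> cf.
have [||m m0 fm] := @compact_uniformly _ _ [set: K] (fun m x =>
  forall i, m * `|f i x| <= 1) cK.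
- move=> m m' x mm' fx i; apply: le_trans (fx i).
  by rewrite ler_wpM2r.
- move=> x _; have [r r0 xr] := cts_ball_fam x cf ltr01.
  pose S := \sum_i `|f i x| + 1.
  have S0 : 0 < S by rewrite ltr_wpDl// sumr_ge0.
  exists r, S^-1; split; rewrite ?invr_gt0// => y xy i.
  rewrite ler_pdivrMl// mulr1 /S (bigD1 i)//=.
  have := xr y xy i; have := ler_normD (f i x) (f i y - f i x).
  have : 0 <= \sum_(j < n | j != i) `|f j x| by exact: sumr_ge0.
  rewrite (_ : f i x + (f i y - f i x) = f i y); last by ring.
  by lra.
- exists m^-1; first by rewrite invr_gt0.
  by move=> i x; rewrite -[leRHS]mulr1 ler_pdivlMl// fm.
Qed.

(* After moving [f] off the lattice points, push it radially (in the max norm)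
   out of the disjoint cubes of radius [rho] around them. *)
Lemma avoid_lattice n (f : 'I_n -> K -> R) rho e :
  escapable n [set: K] -> (forall i, continuous (f i)) -> 0 < rho -> 0 < e ->
  exists2 y : 'I_n -> K -> R, (forall i, continuous (y i)) &
    (forall i x, `|y i x - f i x| <= e + rho) /\
    forall (z : 'I_n -> int) x,
      exists i, rho <= `|y i x - 2 * rho * (z i)%:~R|.
Proof.
move=> esc cf rho0 e0.
have [B B0 fB] := coords_bounded cf.
have rho20 : 0 < 2 * rho by rewrite mulr_gt0.
(* Lattice points with an index beyond [M] in absolute value are out of reach of the bounded image,
   so the finitely many points of [J] suffice. *)
pose M := (Num.truncn ((B + e) / (2 * rho))).+1.
have MB : B + e <= 2 * rho * M%:R.
  by rewrite -ler_pdivrMl// mulrC ltW// truncnS_gt.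
pose J : finType := {ffun 'I_n -> 'I_(2 * M).+1}.
pose p (phi : J) (i : 'I_n) : R := 2 * rho * ((phi i)%:R - M%:R).
have [||g cg [gf [m m0 gm]]] :=
  @escape_seq _ _ J n (enum J) (fun=> [set: K]) p f e _ cf.
- by move=> phi _; split.
- by [].
pose N phi x := \big[Num.max/0]_i `|g i x - p phi i|.
have cN phi : continuous (N phi).
  apply: bigmax_cts => i; apply: norm_cts; apply: sub_cts => //.
  exact: cst_cts.
have N_ge phi x i : `|g i x - p phi i| <= N phi x.
  exact: (le_bigmax _ (fun i => `|g i x - p phi i|)).
have N_gt0 phi x : 0 < N phi x.
  have [|i mi] := gm phi _ x I; first by rewrite mem_enum.
  exact: lt_le_trans m0 (le_trans mi (N_ge _ _ _)).
have N_eq phi x : exists i, N phi x = `|g i x - p phi i|.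
  have : N phi x = 0 \/ exists i, N phi x = `|g i x - p phi i|.
    rewrite /N; apply: (big_ind (fun v => v = 0 \/ exists i, v = `|g i x - p
      phi i|)).
    - by left.
    - by move=> a b ha hb; rewrite maxEle; case: ifP.
    - by move=> i _; right; exists i.
  by case=> // N0; have := N_gt0 phi x; rewrite N0 ltxx.
(* The term of [phi] stretches [g - p phi] to max norm [rho] when it is shorter and is 0 otherwise.
   Lattice points are [2 * rho] apart, so at most one term is nonzero. *)
pose y i x := g i x +
  \sum_(phi : J) (g i x - p phi i) * Num.max 0 (rho / N phi x - 1).
have cy i : continuous (y i).
  apply: add_cts => //; apply: sum_cts => phi; apply: mul_cts.
    by apply: sub_cts => //; exact: cst_cts.
  apply: max_cts; first exact: cst_cts.
  apply: sub_cts; last exact: cst_cts.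
  apply: mul_cts; first exact: cst_cts.
  by apply: inv_cts => // x; rewrite gt_eqF.
have p_neq phi psi : phi != psi -> exists i, 2 * rho <= `|p phi i - p psi i|.
  move=> pp; have [i ip] : exists i, phi i != psi i.
    apply/existsP; rewrite -negb_forall; apply: contra pp => /forallP pp.
    by apply/eqP/ffunP => i; exact/eqP.
  exists i; rewrite /p -mulrBr normrM (gtr0_norm rho20) -[leLHS]mulr1.
  rewrite ler_wpM2l ?(ltW rho20)//.
  have -> : (phi i)%:R - M%:R - ((psi i)%:R - M%:R) =
    (phi i)%:R - (psi i)%:R :> R by ring.
  wlog lt : phi psi pp ip / (phi i < psi i)%N.
    move=> h; have [lt|lt|eq] := ltngtP (phi i) (psi i); first exact: h.
      by rewrite distrC; apply: h => //; rewrite eq_sym.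
    by move/eqP : ip => /(_ (val_inj eq)).
  by rewrite distrC -natrB ?(ltnW lt)// normr_nat ler1n subn_gt0.
have term0 phi x : rho <= N phi x -> Num.max 0 (rho / N phi x - 1) = 0.
  by move=> le; rewrite max_l// subr_le0 ler_pdivrMr// mul1r.
have yP x : (forall phi, rho <= N phi x) /\ (forall i, y i x = g i x) \/
    exists phi, [/\ N phi x < rho,
      forall i, y i x = p phi i + (g i x - p phi i) * (rho / N phi x) &
      forall i, `|y i x - p phi i| <= rho].
  have [le|/existsNP[phi /negP]] := pselect (forall phi, rho <= N phi x).
    left; split=> // i; rewrite /y big1 ?addr0// => phi _.
    by rewrite term0// mulr0.
  rewrite -ltNge => lt; right; exists phi.
  have yE i : y i x = p phi i + (g i x - p phi i) * (rho / N phi x).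
    rewrite /y (bigD1 phi)//= [X in _ + (_ + X)]big1 => [|psi psiphi].
      have -> : Num.max 0 (rho / N phi x - 1) = rho / N phi x - 1.
        by rewrite max_r// subr_ge0 ler_pdivlMr// mul1r ltW.
      by ring.
    rewrite term0 ?mulr0//; have [j pj] := p_neq _ _ psiphi.
    have := N_ge psi x j; have := N_ge phi x j.
    have := ler_distD (g j x) (p psi j) (p phi j).
    by rewrite (distrC (p psi j) (g _ _)); lra.
  split=> // i; rewrite yE addrC addKr normrM (ger0_norm (divr_ge0 (ltW rho0)
    (ltW (N_gt0 _ _)))).
  by rewrite mulrCA ger_pMr// ler_pdivrMr// mul1r N_ge.
have yg i x : `|y i x - g i x| <= rho.
  have [[_ ->]|[phi [lt yE yp]]] := yP x; first by rewrite subrr normr0 ltW.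
  have -> : y i x - g i x = (g i x - p phi i) * (rho / N phi x - 1).
    by rewrite yE; ring.
  rewrite normrM [X in _ * X]ger0_norm; last first.
    by rewrite subr_ge0 ler_pdivlMr// mul1r ltW.
  apply: (@le_trans _ _ (N phi x * (rho / N phi x - 1))).
    by rewrite ler_wpM2r// subr_ge0 ler_pdivlMr// mul1r ltW.
  rewrite mulrBr mulr1 mulrCA divff ?gt_eqF// mulr1.
  by have := N_gt0 phi x; lra.
exists y => //; split=> [i x|z x].
  have := ler_distD (g i x) (y i x) (f i x); have := gf i x; have := yg i x.
  by lra.
have [zM|/existsNP[i /negP]] := pselect (forall i, `|z i| <= M%:Z).
  pose psi : J := [ffun i => inord (absz (z i + M%:Z))].
  have pz i : 2 * rho * (z i)%:~R = p psi i.
    rewrite /p ffunE inordK; last by have := zM i; lia.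
    rewrite (pmulrn 1 (absz _)) gez0_abs; last by have := zM i; lia.
    by rewrite intrD -pmulrn addrK.
  under eq_exists do rewrite pz.
  have [[le yE]|[phi [lt yE yp]]] := yP x.
    have [i Ni] := N_eq psi x; exists i; rewrite yE -Ni; exact: le.
  have [->|pp] := eqVneq psi phi.
    have [i Ni] := N_eq phi x; exists i.
    rewrite yE addrC addKr normrM -Ni ger0_norm ?divr_ge0 ?(ltW rho0) ?(ltW
      (N_gt0 _ _))//.
    by rewrite mulrCA divff ?mulr1// gt_eqF.
  have [i pi] := p_neq _ _ pp; exists i.
  have := ler_distD (y i x) (p psi i) (p phi i); have := yp i.
  by rewrite (distrC (p psi i) (y _ _)); lra.
rewrite -ltNge => Mz; exists i.
have zM : 2 * rho * (M%:R + 1) <= `|2 * rho * (z i)%:~R|.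
  rewrite normrM (gtr0_norm rho20) ler_wpM2l ?(ltW rho20)//.
  have : (M%:Z + 1 <= `|z i|)%R by lia.
  by rewrite -(ler_int R) intrD intr_norm.
have := ler_distD (g i x) (y i x) 0; have := ler_distD (f i x) (g i x) 0.
have := ler_distD (y i x) (2 * rho * (z i)%:~R) 0.
rewrite !subr0 (distrC _ (y i x)).
have := fB i x; have := gf i x; have := yg i x.
by move: MB zM; rewrite mulrDr mulr1; lra.
Qed.

End AvoidLattice.

(** * Covering numbers of porous sets *)

Section Porosity.
Context {R : realType} {d : nat}.
Notation E := (euclidean R d).
Implicit Types (A : set E).

(** Porosity in the form in which the game produces it: holes around the points of a cubic lattice,
    at scales in geometric progression. *)
Definition porous A : Prop :=
  exists q rho : R, [/\ 0 < q < 1, 0 < rho &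
    forall (n : nat) (z : 'I_d -> int) v, A v -> exists i,
      rho * q ^+ n / 2 <= `|ecoord v i - 2 * (rho * q ^+ n) * (z i)%:~R|].

Definition cube (a : {ffun 'I_d -> R}) (L : R) : set E :=
  [set v | forall i, a i <= ecoord v i <= a i + L].

Definition subcube (a : {ffun 'I_d -> R}) (L : R) M
    (j : {ffun 'I_d -> 'I_M}) : {ffun 'I_d -> R} :=
  [ffun i => a i + L / M%:R * (j i)%:R].

Lemma exists_expr_lt (q e : R) : 0 < q < 1 -> 0 < e -> exists n, q ^+ n < e.
Proof.
move=> /andP[q0 q1] e0.
have /cvgrPdist_lt/(_ _ e0)[n _ /(_ n (leqnn n))] : q ^+ n @[n --> \oo] --> (0
  : R).
  by apply: cvg_expr; rewrite gtr0_norm.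
by rewrite /= sub0r normrN gtr0_norm ?exprn_gt0//; exists n.
Qed.

(** A cube of side [L] contains a lattice point of a scale comparable to [L]. For large [M] the
    subcube holding that point lies inside the hole around it. *)
Lemma porous_subcube A L1 : porous A -> 0 < L1 ->
  exists M, (2 <= M)%N /\ forall a L, 0 < L <= L1 ->
    exists j : {ffun 'I_d -> 'I_M}, forall v, A v ->
      ~ cube (subcube a L j) (L / M%:R) v.
Proof.
move=> [q [rho [q01 rho0 pA]]] L10; have /andP[q0 q1] := q01.
(* For the first [n] with [2 * r n <= L], [r n] is at least [q / 2 * L] if [n > 0], and at least
   [rho / L1 * L] if [n = 0]. *)
pose k := Num.min (q / 2) (rho / L1).
have k0 : 0 < k by rewrite lt_min !divr_gt0.
pose M' := (Num.truncn (2 / k)).+1; pose M := M'.+1.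
have M0 : 0 < M%:R :> R by rewrite ltr0n.
have Mk : 2 / k < M%:R.
  by rewrite (lt_le_trans (truncnS_gt _))// ler_nat.
exists M; split=> // a L /andP[L0 LL1].
have Ln0 : L != 0 by rewrite gt_eqF.
pose r n : R := rho * q ^+ n.
have r0 n : 0 < r n by rewrite mulr_gt0// exprn_gt0.
have exn : exists n, 2 * r n <= L.
  have [|n qn] := exists_expr_lt (e := L / (2 * rho)) q01.
    by rewrite divr_gt0// mulr_gt0.
  exists n; rewrite /r mulrA -ler_pdivlMl ?mulr_gt0// mulrC.
  exact: ltW.
have [n rnL rnk] : exists2 n, 2 * r n <= L & k * L <= r n.
  exists (ex_minn exn); first by case: ex_minnP.
  case: ex_minnP => -[|n] rL nmin.
    rewrite /r expr0 mulr1 (@le_trans _ _ (rho / L1 * L))//.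
      by rewrite ler_wpM2r ?ge_min ?lexx ?orbT// ltW.
    by rewrite mulrAC ler_pdivrMr// ler_wpM2l// ltW.
  have : L < 2 * r n by rewrite ltNge; apply/negP => /nmin; rewrite ltnn.
  move=> Lr; rewrite (@le_trans _ _ (q / 2 * L))//.
    by rewrite ler_wpM2r ?ge_min ?lexx// ltW.
  have -> : r n.+1 = q / 2 * (2 * r n) by rewrite /r exprS; field.
  by rewrite ler_wpM2l ?divr_ge0// ltW.
have LMr : L / M%:R < r n / 2.
  have h1 : L <= r n / k by rewrite ler_pdivlMr// mulrC.
  have h2 : r n * (2 / k) < r n * M%:R by rewrite ltr_pM2l.
  by rewrite ltr_pdivrMr//; lra.
pose z (i : 'I_d) : int := Num.ceil (a i / (2 * r n)).
pose c i := 2 * r n * (z i)%:~R.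
have rn2 : 0 < 2 * r n by rewrite mulr_gt0.
have ca i : a i <= c i < a i + L.
  have := ceil_itv (a i / (2 * r n)); rewrite -/(z i) => /andP[z1 z2].
  apply/andP; split; first by rewrite /c mulrC -ler_pdivrMr.
  apply: lt_le_trans (_ : a i + 2 * r n <= _); last by rewrite lerD2l.
  rewrite -ltrBlDr -[X in _ - X]mulr1 -mulrBr mulrC -ltr_pdivlMr//.
  by move: z1; rewrite intrD.
pose t i : R := (c i - a i) * M%:R / L.
have t0 i : 0 <= t i.
  by have /andP[? ?] := ca i; rewrite divr_ge0 ?mulr_ge0 ?subr_ge0// ltW.
have tM i : (Num.truncn (t i) < M)%N.
  rewrite truncn_lt_nat// ltr_pdivrMr// mulrC ltr_pM2l//.
  by have /andP[? ?] := ca i; rewrite ltrBlDl.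
exists [ffun i => Ordinal (tM i)] => v Av Qv.
have [i] := pA n z v Av; apply/negP; rewrite -ltNge.
rewrite -/(r n) -/(c i) (le_lt_trans _ LMr)//.
have := Qv i; rewrite !ffunE /= => /andP[v1 v2].
have /andP[t1 t2] := truncn_itv (t0 i).
have LM0 : 0 < L / M%:R by rewrite divr_gt0.
have cE : c i = a i + L / M%:R * t i.
  by rewrite /t; field; rewrite Ln0 gt_eqF.
rewrite -(ler_pM2l LM0) in t1; rewrite -(ltr_pM2l LM0) -[_.+1%:R]natr1 in t2.
by rewrite cE ler_norml; apply/andP; split; lra.
Qed.

Lemma in_subcube (a : {ffun 'I_d -> R}) L M v : (0 < M)%N -> 0 < L ->
  cube a L v ->
  exists j : {ffun 'I_d -> 'I_M}, cube (subcube a L j) (L / M%:R) v.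
Proof.
case: M => [//|M _ L0 Qv]; have M0 : 0 < M.+1%:R :> R by rewrite ltr0n.
pose t i : R := (ecoord v i - a i) * M.+1%:R / L.
have t0 i : 0 <= t i.
  by have /andP[? ?] := Qv i; rewrite divr_ge0 ?mulr_ge0 ?subr_ge0// ltW.
have tM i : t i <= M.+1%:R.
  rewrite ler_pdivrMr// mulrC ler_pM2l//.
  by have /andP[? ?] := Qv i; rewrite lerBlDl.
(* The minimum puts points of the far faces into the last subcube. *)
exists [ffun i => inord (minn (Num.truncn (t i)) M)] => i.
rewrite !ffunE inordK ?ltnS ?geq_minr//.
have LM0 : 0 < L / M.+1%:R by rewrite divr_gt0.
have vE : ecoord v i = a i + L / M.+1%:R * t i.
  by rewrite /t; field; rewrite !gt_eqF.
rewrite vE -addrA !lerD2l -[X in _ <= _ + X]mulr1 -mulrDr !ler_pM2l// natr1.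
have /andP[t1 t2] := truncn_itv (t0 i).
apply/andP; split.
  by rewrite (le_trans _ t1)// ler_nat geq_minl.
have [tle|tgt] := leqP (Num.truncn (t i)) M; first exact: ltW.
exact: tM.
Qed.

(** Each of the [k] subdivisions discards one of the [M ^ d] subcubes of every remaining cube. *)
Lemma cube_cover A L1 M k : (0 < M)%N ->
  (forall a L, 0 < L <= L1 -> exists j : {ffun 'I_d -> 'I_M}, forall v, A v ->
      ~ cube (subcube a L j) (L / M%:R) v) ->
  forall a L, 0 < L <= L1 ->
  exists2 s : seq {ffun 'I_d -> R}, (size s <= (M ^ d).-1 ^ k)%N &
    forall v, A v -> cube a L v ->
      exists2 b, b \in s & cube b (L / M%:R ^+ k) v.
Proof.
move=> M0 pore; have MR1 : 1 <= M%:R :> R by rewrite ler1n.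
have MR0 : 0 < M%:R :> R by rewrite ltr0n.
elim: k => [|k ih] a L L01.
  by exists [:: a] => // v _; rewrite expr0 divr1; exists a; rewrite ?mem_head.
have /andP[L0 LL1] := L01; have [j0 j0P] := pore a L L01.
have LM1 : 0 < L / M%:R <= L1.
  rewrite divr_gt0//= (le_trans _ LL1)// ler_pdivrMr//.
  by rewrite ler_peMr// ltW.
have /choice[S SP] (j : {ffun 'I_d -> 'I_M}) :
    exists s : seq {ffun 'I_d -> R}, (size s <= (M ^ d).-1 ^ k)%N /\
      forall v, A v -> cube (subcube a L j) (L / M%:R) v ->
      exists2 b, b \in s & cube b (L / M%:R / M%:R ^+ k) v.
  by have [s ? ?] := ih (subcube a L j) _ LM1; exists s.
exists [seq b | j <- enum (predC1 j0), b <- S j].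
  rewrite size_allpairs_dep sumnE big_map.
  rewrite (@leq_trans (\sum_(j <- enum (predC1 j0)) (M ^ d).-1 ^ k)%N)//.
    by apply: leq_sum => j _; have [] := SP j.
  by rewrite big_enum sum_nat_const cardC1 card_ffun !card_ord expnS.
move=> v Av Qv; have [j vj] := in_subcube M0 L0 Qv.
have [_ /(_ v Av vj)[b bS bv]] := SP j.
exists b; last by rewrite exprS invfM mulrA.
apply/allpairsPdep; exists j, b; split=> //.
by rewrite mem_enum inE; apply: contra_notN (j0P v Av) => /eqP <-.
Qed.

(** A cube of side [l] lies in the open ball of radius [2 * d * l] around its corner. *)
Lemma covering_number_le A r l (s : seq {ffun 'I_d -> R}) :
  0 < l -> 4 * d%:R * l <= r -> (0 < d)%N ->
  (forall v, A v -> exists2 b, b \in s & cube b l v) ->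
  (covering_number r A <= (size s)%:R%:E)%E.
Proof.
move=> l0 lr d0 As; have dR0 : 0 < d%:R :> R by rewrite ltr0n.
pose c (b : {ffun 'I_d -> R}) : E := (\row_i b i : 'rV[R]_d).
pose B b := [set v | mdist (c b) v < 2 * d%:R * l].
pose C := [set B b | b in [set` s]].
have Cs : (C #<= `I_(size s))%card.
  have [s0|s0] := eqVneq s [::].
    by rewrite /C s0 set_nil image_set0 card_ge0.
  have [b0 b0s] : exists b, b \in s by case: (s) s0 => // b ? _; exists b;
    rewrite mem_head.
  apply: (card_le_trans _ (card_image_le (fun k => B (nth b0 s k)) _)).
  apply: subset_card_le => _ [b /= bs <-]; exists (index b s) => /=.
    by rewrite index_mem.
  by rewrite nth_index.
have [n Cn] : finite_set C by apply/finite_set_leP; exists (size s).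
apply: (@le_trans _ _ n%:R%:E); last first.
  by rewrite lee_fin ler_nat -card_le_II -(card_le_eql Cn).
apply: ereal_inf_lbound; exists n => //; exists C; split=> //.
  by move=> _ [b _ <-]; exact: open_mball_lt.
split=> [v Av|_ [b _ <-]].
  have [b bs bv] := As v Av; exists (B b); first by exists b.
  apply: (@le_lt_trans _ _ (d%:R * l)).
    apply: mdist_le_coord => i; rewrite /c {1}/ecoord mxE.
    by have /andP[? ?] := bv i; rewrite ler_norml; apply/andP; split; lra.
  by have := mulr_gt0 dR0 l0; lra.
apply: diam_le => [|v w].
  by rewrite (le_trans _ lr)// !mulr_ge0// ltW.
rewrite /B/= => v1 w1; have := metric_triangle v (c b) w.
by rewrite (metric_sym v (c b)); lra.
Qed.

(** The bound is the similarity dimension [s], determined by [M ^ s = M ^ d - 1], hence less than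
    [d]. *)
Lemma porous_assouad A D : (0 < d)%N -> 0 < D ->
  (forall v, A v -> forall i, `|ecoord v i| <= D) -> porous A ->
  (assouad_dim A < d%:R%:E)%E.
Proof.
move=> d0 D0 AD pA; have D20 : 0 < 2 * D by rewrite mulr_gt0.
have [M [M2 pore]] := porous_subcube pA D20.
have M0 : (0 < M)%N by exact: leq_trans M2.
have MR1 : 1 < M%:R :> R by rewrite ltr1n.
have MR0 : 0 < M%:R :> R by rewrite ltr0n.
have lnM : 0 < ln (M%:R : R) by rewrite ln_gt0.
pose m := (M ^ d).-1.
have Md : (2 <= M ^ d)%N by rewrite (leq_trans M2)// -[leqLHS]expn1 leq_exp2l.
have m1 : (1 <= m)%N by rewrite /m; lia.
have mMd : (m < M ^ d)%N by rewrite /m; lia.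
have mR0 : 0 < m%:R :> R by rewrite ltr0n.
have mR1 : 1 <= m%:R :> R by rewrite ler1n.
pose s : R := ln m%:R / ln M%:R.
have s0 : 0 <= s by rewrite divr_ge0 ?ln_ge0// ltW.
have sd : s < d%:R.
  rewrite /s ltr_pdivrMr// mulr_natl -lnXn// ltr_ln ?posrE//.
    by rewrite -natrX ltr_nat.
  by rewrite exprn_gt0.
have Ms : M%:R `^ s = m%:R.
  by rewrite /powR gt_eqF// /s divfK ?gt_eqF// lnK.
have Mks k : (M%:R ^+ k) `^ s = m%:R ^+ k.
  by rewrite -powR_mulrn ?(ltW MR0)// -powRrM mulrC powRrM Ms powR_mulrn// ltW.
apply: (@le_lt_trans _ _ s%:E); last by rewrite lte_fin.
apply: ereal_inf_lbound; exists s => //; split=> //.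
have dR0 : 0 < d%:R :> R by rewrite ltr0n.
have C0 : 0 < (8 * d%:R) `^ s :> R by rewrite powR_gt0// mulr_gt0.
exists (m%:R * (8 * d%:R) `^ s); first by rewrite mulr_gt0.
move=> r r' x /andP[r0 rr'] Ax; have r'0 : 0 < r' by exact: lt_trans rr'.
have rr'1 : 1 <= r' / r by rewrite ler_pdivlMr// mul1r ltW.
(* The side is capped at [2 * D], up to which [pore] holds; for larger balls the cube containing all
   of [A] is used. *)
have [a [L [L0 LD Lr' aL]]] : exists (a : {ffun 'I_d -> R}) L,
    [/\ 0 < L, L <= 2 * D, L <= 2 * r' & mball x r' `&` A `<=` cube a L].
  have [rD|Dr] := leP r' D.
    exists [ffun i => ecoord x i - r'], (2 * r'); split=> //.
    - by rewrite mulr_gt0.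
    - by rewrite ler_pM2l.
    - move=> v [xv _] i; rewrite ffunE.
      have := le_trans (ecoord_le x v i) xv; rewrite ler_norml => /andP[? ?].
      by apply/andP; split; lra.
  exists [ffun i => - D], (2 * D); split=> //.
    by rewrite ler_pM2l// ltW.
  move=> v [_ /AD Av] i; rewrite ffunE.
  by have := Av i; rewrite ler_norml => /andP[? ?]; apply/andP; split; lra.
have exk : exists k, 4 * d%:R * (L / M%:R ^+ k) <= r.
  have [||k Mk] := @exists_expr_lt M%:R^-1 (r / (4 * d%:R * L)).
  - by rewrite invr_gt0 MR0 invf_lt1.
  - by rewrite divr_gt0// !mulr_gt0.
  exists k; rewrite mulrA -exprVn mulrC -ler_pdivlMr ?mulr_gt0//.
  exact: ltW.
(* If [k > 0], minimality gives [M ^ (k - 1) <= 8 * d * r' / r]; the last subdivision accounts for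
   the factor [m] in the constant. *)
have [k kr kmin] := ex_minnP exk.
have [|S Sk SA] := @cube_cover A _ M k M0 pore a L; first by rewrite L0.
have Lk0 : 0 < L / M%:R ^+ k by rewrite divr_gt0// exprn_gt0.
apply: (le_trans (covering_number_le (s := S) Lk0 kr d0 _)).
  by move=> v vA; apply: SA; [exact: vA.2|exact: aL].
rewrite lee_fin (@le_trans _ _ (m%:R ^+ k))//; first by rewrite -natrX ler_nat.
case: k {kr Sk SA Lk0 S} kmin => [_|k kmin].
  have pow1 (t : R) : 1 <= t -> 1 <= t `^ s.
    by move=> t1; have := ler_powR t1 s0; rewrite powRr0.
  rewrite expr0 !mulr_ege1 ?pow1//.
  have : 1 <= d%:R :> R by rewrite ler1n.
  by lra.
have Mk0 : 0 < M%:R ^+ k :> R by rewrite exprn_gt0.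
have Mkr : M%:R ^+ k <= 8 * d%:R * (r' / r).
  have : r < 4 * d%:R * (L / M%:R ^+ k).
    by rewrite ltNge; apply/negP => /kmin; rewrite ltnn.
  rewrite mulrA ltr_pdivlMr// mulrC -ltr_pdivlMr// => /ltW/le_trans; apply.
  rewrite [leRHS]mulrA ler_pM2r ?invr_gt0//.
  rewrite -mulrA [leRHS](_ : _ = 4 * d%:R * (2 * r')); last by ring.
  by rewrite mulrA ler_wpM2l// mulr_ge0// ltW.
rewrite exprS -Mks -mulrA ler_wpM2l ?(ltW mR0)// -powRM ?divr_ge0 ?mulr_ge0
  ?(ltW r0) ?(ltW r'0)//.
by apply: ge0_ler_powR; rewrite ?nnegrE// ?(ltW Mk0)// (le_trans (ltW Mk0)).
Qed.

End Porosity.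

(** * Playing for a porous image *)

Section PorousGame.
Context {R : realType} {K : metricType R} (cK : compact [set: K]) (d : nat).
Notation F := (cfun (euclidean R d) cK).

Lemma porous_winning : (0 < d)%N -> escapable d [set: K] ->
  winning [set f : F | porous (range f)].
Proof.
move=> d0 esc; have dR1 : 1 <= d%:R :> R by rewrite ler1n.
have dR0 : 0 < d%:R :> R by rewrite ltr0n.
(* With [rho = r / (4 * d)], leaving the cubes moves Bob's map by at most [r / 2], and the later
   drift [alpha * r = rho / 2] leaves holes of radius [rho / 2]. *)
pose alpha : R := (8 * d%:R)^-1.
have alphaE : alpha * d%:R = 1 / 8 by rewrite /alpha; field; rewrite gt_eqF.
have a0 : 0 < alpha by rewrite invr_gt0 mulr_gt0.
have a1 : alpha <= 1 / 8 by nra.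
have a01 : 0 < alpha < 1 by apply/andP; split=> //; lra.
exists alpha => // beta b01; have /andP[b0 b1] := b01.
pose rho (r0 : R) n := game_radius alpha beta r0 n / (4 * d%:R).
apply: (@state_winning _ _ _ _ _ unit tt (fun _ _ => True)
  (fun r0 n x _ _ y =>
     forall f : F, mdist y f <= alpha * game_radius alpha beta r0 n ->
     forall (z : 'I_d -> int) v, range f v -> exists i,
      rho r0 n / 2 <= `|ecoord v i - 2 * rho r0 n * (z i)%:~R|)) => //.
- move=> r0 n x _ r00 _ r; exists tt.
  have r_gt0 : 0 < r by rewrite mulr_gt0// exprn_gt0// mulr_gt0.
  have rho0 : 0 < rho r0 n by rewrite divr_gt0// mulr_gt0.
  have rhoE : d%:R * (rho r0 n + rho r0 n) = r / 2.
    by rewrite /rho -/r; field; rewrite gt_eqF.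
  have arE : alpha * r = rho r0 n / 2.
    by rewrite /rho -/r /alpha; field; rewrite gt_eqF.
  have [y cy [yx yz]] :=
    avoid_lattice cK esc (ecoord_cts (f := x)) rho0 rho0.
  have [f1 f1E] := cfun_of_coords cK cy.
  exists f1; split=> //.
    move=> f f1f z _ [p _ <-]; have [i zi] := yz z p; exists i.
    have := le_trans (cfun_ecoord_le f1 f p i) f1f; rewrite f1E arE.
    have := ler_distD (ecoord (f p) i) (y i p) (2 * rho r0 n * (z i)%:~R).
    by lra.
  have : mdist x f1 <= d%:R * (rho r0 n + rho r0 n).
    apply: cfun_mdist_le_coord => [|p i]; first by rewrite addr_ge0// ltW.
    by rewrite f1E distrC.
  by rewrite rhoE; nra.
- move=> r0 x y _ f r00 _ rel fy.
  exists (alpha * beta), (r0 / (4 * d%:R)); split.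
  + by rewrite mulr_gt0//= mulr_ilt1// ?ltW//; lra.
  + by rewrite divr_gt0// mulr_gt0.
  + have rhoE n : r0 / (4 * d%:R) * (alpha * beta) ^+ n = rho r0 n.
      by rewrite /rho /game_radius mulrAC (mulrC r0).
    by move=> n z v fv; rewrite rhoE; exact: rel n f (fy n) z v fv.
Qed.

Lemma low_dim_winning : (0 < d)%N -> escapable d [set: K] ->
  winning [set f : F | (assouad_dim (range f) < d%:R%:E)%E].
Proof.
move=> d0 esc; apply: winningS (porous_winning d0 esc) => f pf.
have [B B0 fB] := coords_bounded cK (ecoord_cts (f := f)).
by apply: (porous_assouad d0 B0 _ pf) => _ [x _ <-] i; exact: fB.
Qed.

End PorousGame.

(** * Uncountable spaces and Cantor sets in the image *)

Section Condensation.
Context {R : realType} {K : metricType R} (cK : compact [set: K]).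

Definition condensation (x : K) : Prop :=
  forall e : R, 0 < e -> ~ countable (mball x e).

Lemma not_condensation_countable (A : set K) : compact A ->
  (forall x, A x -> ~ condensation x) -> countable A.
Proof.
move=> cA nA; have /choice[e eP] x : exists e : R, A x ->
    0 < e /\ countable (mball x e).
  have [/nA|//] := pselect (A x); last by exists 0.
  by move=> /existsNP[e /not_implyP[e0 /contrapT ce]]; exists e.
have [x /eP[]//|s sA As] := compact_ball_cover (e := e) cA.
apply: (@sub_countable _ _ _ (\bigcup_(y in [set` s]) mball y (e y))).
  apply: subset_card_le => x /As[y ys yx]; exists y => //.
  exact: ltW.
apply: bigcup_countable; first exact: finite_set_countable (finite_seq s).
by move=> y /= /sA/eP[].
Qed.

Lemma exists_condensation : ~ countable [set: K] -> exists x, condensation x.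
Proof.
move=> nK; apply: contrapT => /forallNP nc; apply: nK.
exact: not_condensation_countable.
Qed.

(** Otherwise the ball without [c] would be the union of the compact annuli [A m], which contain no
    condensation point and so are countable. *)
Lemma condensation_near c e : condensation c -> 0 < e ->
  exists c', [/\ condensation c', c' != c & mdist c c' <= e].
Proof.
move=> cc e0; apply: contrapT => /forallNP nc; apply: (cc e e0).
pose A (m : nat) := mball c e `&` [set x | m.+1%:R^-1 <= mdist c x].
apply: (@sub_countable _ _ _ (\bigcup_m if m is m'.+1 then A m' else [set c])).
  apply: subset_card_le => x cx; have [->|xc] := eqVneq x c;
    first by exists 0%N.
  have m0 : 0 < mdist c x by rewrite mdist_gt0 eq_sym.
  exists (Num.truncn (mdist c x)^-1).+1 => //; split=> //=.
  by rewrite invf_ple ?posrE// ltW// truncnS_gt.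
apply: bigcup_countable => // -[_|m _]; first exact: countable1.
apply: not_condensation_countable.
  apply: compact_closedI; first exact: mball_compact.
  rewrite -[X in closed X]setCK; apply: open_closedC.
  rewrite (_ : ~` _ = [set x | mdist c x < m.+1%:R^-1]);
    first exact: open_mball_lt.
  by apply/seteqP; split=> x /=; rewrite ltNge => /negP.
move=> x [cx xm] condx; apply: (nc x); split=> //.
by apply: contraTneq xm => ->; rewrite mdistxx -ltNge invr_gt0.
Qed.

(* The quotient of products of distances is [1] or [-1] at each prescribed
   point, according to which of the products vanishes there. *)
Lemma interpolate_signs N (c : nat -> K) (sg : nat -> bool) :
  (forall k l, (k < N)%N -> (l < N)%N -> c k = c l -> k = l) ->
  exists2 u : K -> R, continuous u &
    (forall x, `|u x| <= 1) /\
    forall k, (k < N)%N -> u (c k) = if sg k then 1 else -1.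
Proof.
move=> cinj.
pose D b x : R := \prod_(k <- [seq k <- iota 0 N | sg k == b]) mdist (c k) x.
have cD b : continuous (D b) by apply: prod_cts => k; exact: mdist_cts.
have D0 b x : 0 <= D b x by apply: prodr_ge0 => k _; exact: mdist_ge0.
have Dz b x : D b x = 0 -> exists k, [/\ (k < N)%N, sg k = b & x = c k].
  move=> /eqP; rewrite prodf_seq_eq0 => /hasP[k].
  rewrite mem_filter mem_iota add0n => /andP[/eqP kb /andP[_ kN]] /= /eqP ck.
  by exists k; split=> //; apply/esym; exact: mdist_positivity.
have Dc k : (k < N)%N -> D (sg k) (c k) = 0.
  move=> kN; apply/eqP; rewrite prodf_seq_eq0; apply/hasP; exists k.
    by rewrite mem_filter eqxx mem_iota.
  by rewrite /= mdistxx.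
have S0 x : 0 < D true x + D false x.
  rewrite lt_def addr_ge0// andbT; apply/negP => /eqP s0.
  have [|k [kN kt xk]] := Dz true x; first by have := D0 true x; have :=
    D0 false x; lra.
  have [|l [lN lf xl]] := Dz false x; first by have := D0 true x; have :=
    D0 false x; lra.
  by move: kt; rewrite (cinj k l) ?lf// -xk.
exists (fun x => (D false x - D true x) / (D true x + D false x)).
  apply: mul_cts; first exact: sub_cts.
  apply: inv_cts; first exact: add_cts.
  by move=> x; rewrite gt_eqF.
split=> [x|k kN].
  rewrite normrM normfV (gtr0_norm (S0 x)) ler_pdivrMr// mul1r ler_norml.
  by have := D0 true x; have := D0 false x => *; apply/andP; split; lra.
have := S0 (c k); have := Dc k kN; case: (sg k) => ->.
  by rewrite add0r subr0 => Df; rewrite divff// gt_eqF.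
by rewrite addr0 sub0r => Dt; rewrite mulNr divff// gt_eqF.
Qed.

End Condensation.

(** * Growing a separated binary tree during the game *)

Section CantorGame.
Context {R : realType} {K : metricType R} (cK : compact [set: K]) (d : nat).
Notation F := (cfun (euclidean R d.+1) cK).

(* [separated_tree kappa q f]: the [2 ^ m] points of level [m] of a binary tree
   in [K], where [c k] branches off from [c (k - 2 ^ j)] at level [j + 1], are
   mapped by [f] to points whose distance is controlled by the level at which
   they part. *)
Definition separated_tree (kappa q : R) (f : F) : Prop :=
  forall m, exists c : nat -> K, forall k l j,
    (k < 2 ^ m)%N -> (l < 2 ^ m)%N -> (j < m)%N ->
    k = l %[mod 2 ^ j] -> k <> l %[mod 2 ^ j.+1] ->
    kappa * q ^+ j <= mdist (f (c k)) (f (c l)).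

(** Mass distribution on the [2 ^ m] points of level [m], with [s] chosen so that [q ^ s = 1 / 2].
    If [J] is the first level with [kappa * q ^ J <= dlt], points at mutual distance at most [dlt]
    agree up to level [J], so there are at most [2 ^ (m - J)] of them. *)
Lemma separated_tree_content kappa q (f : F) : 0 < kappa -> 0 < q < 1 ->
  separated_tree kappa q f ->
  exists s c, [/\ 0 < s, 0 < c &
    forall r, (c%:E <= hausdorff_content r s (range f))%E].
Proof.
move=> kappa0 /andP[q0 q1] tree; pose s : R := ln 2 / - ln q.
have lnq : ln q < 0 by apply: ln_lt0; rewrite q0 q1.
have s0 : 0 < s by rewrite divr_gt0 ?oppr_gt0// ln_gt0// ltr1n.
have qs : q `^ s = 2^-1.
  rewrite /powR gt_eqF// /s invrN mulrN mulNr divfK ?lt_eqF//.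
  by rewrite expRN lnK// posrE.
have qns n : (q ^+ n) `^ s = 2^-1 ^+ n.
  rewrite -powR_mulrn ?(ltW q0)// -powRrM mulrC powRrM qs powR_mulrn//.
have c0 : 0 < kappa `^ (- s) by exact: powR_gt0.
exists s, (kappa `^ (- s))^-1; split=> //; first by rewrite invr_gt0.
move=> r; apply: content_ge => //; first exact: cfun_range_compact.
move=> eta eta0.
have [m qm] : exists m, q ^+ m < eta / kappa.
  by apply: exists_expr_lt; rewrite ?q0// divr_gt0.
have [c cP] := tree m.
exists ('I_(2 ^ m) : finType), (fun k : 'I_(2 ^ m) => f (c k)); split.
- by rewrite card_ord expn_gt0.
- by move=> k; exists (c k).
move=> A dlt etad Ad.
have mdlt : kappa * q ^+ m <= dlt.
  by rewrite (le_trans _ etad)// mulrC -ler_pdivlMr// ltW.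
have exJ : exists J, kappa * q ^+ J <= dlt by exists m.
have [J Jd Jmin] := ex_minnP exJ.
have Jm : (J <= m)%N by exact: Jmin.
have agree (k l : 'I_(2 ^ m)) : k \in A -> l \in A -> k = l %[mod 2 ^ J].
  move=> kA lA.
  suff : forall j, (j <= J)%N -> k = l %[mod 2 ^ j] by exact.
  elim=> [_|j ih jJ]; first by rewrite !modn1.
  apply: contrapT => kl.
  have := cP k l j (ltn_ord _) (ltn_ord _) (leq_trans jJ Jm) (ih (ltnW jJ)) kl.
  move=> /le_trans/(_ (Ad _ _ kA lA))/Jmin.
  by rewrite leqNgt jJ.
have Acard : (#|A| <= 2 ^ (m - J))%N.
  have lt (k : 'I_(2 ^ m)) : (k %/ 2 ^ J < 2 ^ (m - J))%N.
    by rewrite ltn_divLR ?expn_gt0// -expnD subnK.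
  rewrite -(card_in_imset (f := fun k : 'I_(2 ^ m) => Ordinal (lt k))).
    by rewrite (leq_trans (max_card _))// card_ord.
  move=> k l kA lA /(congr1 val)/= kl; apply: val_inj => /=.
  by rewrite (divn_eq k (2 ^ J)) (divn_eq l (2 ^ J)) kl (agree k l).
rewrite card_ord (@le_trans _ _ (2 ^+ (m - J)))//.
  by rewrite -natrX ler_nat.
have -> : 2 ^+ (m - J) = kappa `^ (- s) * (kappa * q ^+ J) `^ s * (2 ^ m)%:R :>
  R.
  rewrite powRM ?exprn_ge0 ?(ltW q0) ?(ltW kappa0)// mulrA -powRD; last first.
    by rewrite (gt_eqF kappa0) implybT.
  by rewrite addNr powRr0 mul1r qns natrX exprVn mulrC expfB_cond// pnatr_eq0.
rewrite ler_wpM2r// ler_wpM2l ?(ltW c0)//.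
have kq0 : 0 <= kappa * q ^+ J by rewrite mulr_ge0 ?exprn_ge0// ltW.
by apply: ge0_ler_powR; rewrite ?nnegrE ?(ltW s0)// (le_trans kq0).
Qed.

(** Alice's memory: the points of level [n] and a common radius of balls around them, in which all
    descendants will stay. *)
Definition tree_inv n (t : (nat -> K) * R) : Prop :=
  [/\ 0 < t.2, forall k, (k < 2 ^ n)%N -> condensation (t.1 k) &
      forall k l, (k < 2 ^ n)%N -> (l < 2 ^ n)%N -> t.1 k = t.1 l -> k = l].

Definition tree_refines n (t t' : (nat -> K) * R) : Prop :=
  forall k, (k < 2 ^ n.+1)%N ->
    mdist (t'.1 k) (t.1 (k %% 2 ^ n)%N) + t'.2 <= t.2.

Definition tree_separates n (h : R) (f : F) (t : (nat -> K) * R) : Prop :=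
  forall k a b, (k < 2 ^ n)%N ->
    mball (t.1 k) t.2 a -> mball (t.1 (k + 2 ^ n)%N) t.2 b ->
    h <= `|ecoord (f a) ord0 - ecoord (f b) ord0|.

Lemma tree_branch n c rho : tree_inv n (c, rho) ->
  exists c' : nat -> K,
    [/\ forall k, (k < 2 ^ n.+1)%N -> condensation (c' k),
        forall k l, (k < 2 ^ n.+1)%N -> (l < 2 ^ n.+1)%N -> c' k = c' l -> k =
          l &
        forall k, (k < 2 ^ n.+1)%N ->
          mdist (c' k) (c (k %% 2 ^ n)%N) <= rho / 3].
Proof.
move=> [/= rho0 cc cinj]; pose N := (2 ^ n)%N.
have [|dlt dlt0 cd] := @seq_min_pos R _
  [seq kl : 'I_N * 'I_N <- enum {: 'I_N * 'I_N} | kl.1 != kl.2]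
  (fun kl => mdist (c kl.1) (c kl.2)).
  move=> [k l]; rewrite mem_filter /= => /andP[kl _].
  by rewrite mdist_gt0; apply: contraNneq kl => /cinj kl; apply/eqP/val_inj/kl.
have {}cd k l : (k < N)%N -> (l < N)%N -> k <> l -> dlt <= mdist (c k) (c l).
  move=> kN lN kl; apply: (cd (Ordinal kN, Ordinal lN)).
  rewrite mem_filter mem_enum inE andbT /=.
  by apply/negP => /eqP/(congr1 val).
(* The bound [dlt / 3] keeps new points distinct from other branches; [rho / 3] keeps them well
   inside the parent's ball. *)
pose tau := Num.min rho dlt / 3.
have tau0 : 0 < tau by rewrite divr_gt0// lt_min rho0.
have tau_rho : tau <= rho / 3 by rewrite ler_pM2r// ge_min lexx.
have tau_dlt : tau <= dlt / 3 by rewrite ler_pM2r// ge_min lexx orbT.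
have /choice[c1 c1P] k : exists x, (k < N)%N ->
    [/\ condensation x, x != c k & mdist (c k) x <= tau].
  have [kN|kN] := boolP (k < N)%N; last by exists (c k).
  by have [x ?] := condensation_near cK (cc k kN) tau0; exists x.
have N2 : (2 ^ n.+1 = N + N)%N by rewrite expnS mul2n -addnn.
have subN k : (k < 2 ^ n.+1)%N -> ~~ (k < N)%N -> (k - N < N)%N.
  by rewrite N2 -leqNgt; lia.
exists (fun k => if (k < N)%N then c k else c1 (k - N)%N); split.
- move=> k kN; case: ifPn => [/cc//|/(subN k kN) kN'].
  by have [] := c1P _ kN'.
- move=> k l kN lN.
  wlog kl : k l kN lN / (k <= l)%N.
    move=> h; have [/h|/ltnW/h] := leqP k l; first exact.
    by move=> {}h e; apply/esym/h.
  case: ifPn => [k1|k1']; case: ifPn => [l1|l1].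
  + exact: cinj.
  + have l2 := subN l lN l1; have [_ cl lt] := c1P _ l2 => ck.
    have [kl'|kl'] := eqVneq k (l - N)%N; last move/eqP : kl' => kl'.
      by move: cl; rewrite -ck kl' eqxx.
    by exfalso; have := cd _ _ k1 l2 kl'; rewrite ck metric_sym; lra.
  + by move: k1'; rewrite (leq_ltn_trans kl l1).
  + have k1 := subN k kN k1'; have l2 := subN l lN l1; have [_ _ lt] :=
    c1P _ l2 => ck.
    have [_ _ kt] := c1P _ k1.
    have [kl'|kl'] := eqVneq (k - N)%N (l - N)%N; last move/eqP : kl' => kl'.
      by rewrite -(subnK (_ : N <= k)%N) 1?leqNgt// kl' subnK// leqNgt.
    exfalso; have := cd _ _ k1 l2 kl'.
    have := metric_triangle (c (k - N)%N) (c1 (k - N)%N) (c (l - N)%N).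
    by rewrite {2}ck (metric_sym (c1 (l - N)%N)); lra.
- move=> k kN; case: ifPn => [k1|k1].
    by rewrite modn_small// mdistxx divr_ge0// ltW.
  have k2 := subN k kN k1; have [_ _ kt] := c1P _ k2.
  rewrite (_ : (k %% 2 ^ n)%N = (k - N)%N); last first.
    by rewrite -{1}(subnK (_ : (N <= k)%N)) ?modnDr ?modn_small// leqNgt.
  by rewrite metric_sym (le_trans kt).
Qed.

(** Adding [H * u] to the first coordinate raises the larger and lowers the smaller of two sibling
    values, making their gap at least [2 * H]. On balls of radius [rho'] each value varies by less
    than [H / 4], so more than [H] remains. *)
Lemma tree_step n c rho (f : F) H : tree_inv n (c, rho) -> 0 < H ->
  exists c' rho' (g : F), [/\ tree_inv n.+1 (c', rho'),
    tree_refines n (c, rho) (c', rho'), tree_separates n H g (c', rho') &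
    mdist f g <= H].
Proof.
move=> inv H0; have rho0 : 0 < rho by have [] := inv.
have [c' [cc' cinj' cnear]] := tree_branch inv; pose N := (2 ^ n)%N.
have N2 : (2 ^ n.+1 = N + N)%N by rewrite expnS mul2n -addnn.
pose f0 x := ecoord (f x) ord0.
pose sg k := if (k < N)%N then f0 (c' (k + N)%N) <= f0 (c' k)
  else ~~ (f0 (c' k) <= f0 (c' (k - N)%N)).
have [u cu [u1 uc]] := interpolate_signs sg cinj'.
pose y (i : 'I_d.+1) x := ecoord (f x) i + if i == ord0 then H * u x else 0.
have cy i : continuous (y i).
  apply: add_cts; first exact: ecoord_cts.
  case: (i == ord0); last exact: cst_cts.
  by apply: mul_cts => //; exact: cst_cts.
have [g gE] := cfun_of_coords cK cy.
have H4 : 0 < H / 4 by rewrite divr_gt0.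
have [e e0 ge] := unif_cts cK (ecoord_cts (f := g)) H4.
pose rho' := Num.min (rho / 3) (e / 2).
have rho'0 : 0 < rho' by rewrite lt_min !divr_gt0.
have rho'_rho : rho' <= rho / 3 by rewrite ge_min lexx.
have rho'_e : rho' <= e / 2 by rewrite ge_min lexx orbT.
exists c', rho', g; split=> //.
- by move=> k kN /=; have := cnear k kN; lra.
- move=> k a b kN ka kb.
  have kN1 : (k < 2 ^ n.+1)%N by rewrite N2; move: kN; rewrite -/N; lia.
  have kN2 : (k + N < 2 ^ n.+1)%N by rewrite N2; move: kN; rewrite -/N; lia.
  have ga : `|ecoord (g a) ord0 - ecoord (g (c' k)) ord0| < H / 4.
    by apply: ge; rewrite (le_lt_trans ka)//=; lra.
  have gb : `|ecoord (g b) ord0 - ecoord (g (c' (k + N)%N)) ord0| < H / 4.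
    by apply: ge; rewrite (le_lt_trans kb)//=; lra.
  move: ga gb; rewrite (gE (c' k)) (gE (c' (k + N)%N)) /y eqxx.
  rewrite (uc _ kN1) (uc _ kN2) /sg kN ltnNge leq_addl/= addnK.
  rewrite -/(f0 (c' k)) -/(f0 (c' (k + N)%N)).
  set ga := ecoord (g a) ord0; set gb := ecoord (g b) ord0.
  case: (leP (f0 (c' (k + N)%N)) (f0 (c' k))) => /= le.
    rewrite !ltr_norml => /andP[? ?] /andP[? ?].
    by rewrite (le_trans _ (ler_norm _))//; lra.
  rewrite !ltr_norml => /andP[? ?] /andP[? ?].
  by rewrite distrC (le_trans _ (ler_norm _))//; lra.
- apply: cfun_mdist_le => [|x]; first exact: ltW.
  rewrite (bigD1 ord0)//= big1 => [|i i0].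
    rewrite gE /y eqxx addr0 opprD addNKr normrN normrM (gtr0_norm H0).
    by rewrite ger_pMr.
  by rewrite gE /y (negbTE i0) addr0 subrr normr0.
Qed.

Lemma separated_tree_winning : ~ countable [set: K] ->
  winning [set f : F | exists kappa q,
    [/\ 0 < kappa, 0 < q < 1 & separated_tree kappa q f]].
Proof.
(* For [alpha = 1 / 4] a move of size [3 * alpha * r] is just legal. Each of two sibling values
   drifts by at most [alpha * r] afterwards, so a gap of [alpha * r] survives. *)
move=> /(exists_condensation cK)[x0 cx0]; pose alpha : R := 1 / 4.
have a0 : 0 < alpha by rewrite divr_gt0.
have a01 : 0 < alpha < 1 by rewrite /alpha; apply/andP; split; lra.
exists alpha => // beta b01; have /andP[b0 b1] := b01.
pose r r0 n := game_radius alpha beta r0 n.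
apply: (@state_winning _ _ _ _ _ _ (cst x0, 1) tree_inv
  (fun r0 n _ t t' y => tree_refines n t t' /\
     tree_separates n (3 * alpha * r r0 n) y t')) => //.
- by split=> //= -[|k] [|l]; rewrite expn0.
- move=> r0 n x [c rho] r00 inv; rewrite -/(r r0 n) /=.
  have rn0 : 0 < r r0 n by rewrite mulr_gt0// exprn_gt0// mulr_gt0.
  have [|c' [rho' [g [inv' ref sep xg]]]] :=
    @tree_step _ _ _ x (3 * alpha * r r0 n) inv.
    by rewrite mulr_gt0// mulr_gt0.
  exists (c', rho'), g; split=> //.
  by move: xg; rewrite /alpha; lra.
- move=> r0 x y t f r00 inv rel yf; exists (alpha * r0), (alpha * beta).
  split; first by rewrite mulr_gt0.
    by rewrite mulr_gt0//= mulr_ilt1// ?ltW//; case/andP: a01.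
  have nested m j k : (j <= m)%N -> (k < 2 ^ m)%N ->
      mdist ((t m).1 k) ((t j).1 (k %% 2 ^ j)%N) + (t m).2 <= (t j).2.
    elim: m k => [|m ih] k.
      by rewrite leqn0 => /eqP ->; rewrite expn0; case: k => // _;
        rewrite modn1 mdistxx add0r.
    rewrite leq_eqVlt => /predU1P[->|jm] km.
      by rewrite modn_small// mdistxx add0r.
    have [ref _] := rel m; have := ref k km.
    have km2 : (k %% 2 ^ m < 2 ^ m)%N by rewrite ltn_pmod// expn_gt0.
    have := ih _ jm km2.
    rewrite modn_dvdm ?dvdn_exp2l//.
    have := metric_triangle ((t m.+1).1 k) ((t m).1 (k %% 2 ^ m)%N)
      ((t j).1 (k %% 2 ^ j)%N).
    by lra.
  have sep m k l j : (k < 2 ^ m)%N -> (l < 2 ^ m)%N -> (j < m)%N ->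
      (k %% 2 ^ j.+1 < 2 ^ j)%N ->
      (l %% 2 ^ j.+1 = k %% 2 ^ j.+1 + 2 ^ j)%N ->
      alpha * r r0 j <= mdist (f ((t m).1 k)) (f ((t m).1 l)).
    move=> km lm jm kj lk; have [_ tsep] := rel j.
    have bk := nested m j.+1 k jm km; have bl := nested m j.+1 l jm lm.
    have [tm0 _ _] := inv m.
    have := tsep (k %% 2 ^ j.+1)%N ((t m).1 k) ((t m).1 l) kj.
    rewrite -lk /mball /= metric_sym => /(_ _)/(_ _) h.
    have {}h := h (ltac:(lra)); rewrite metric_sym in h.
    have {}h := h (ltac:(lra)).
    have := ecoord_le (f ((t m).1 k)) (f ((t m).1 l)) ord0.
    have := le_trans (cfun_ecoord_le (y j) f ((t m).1 k) ord0) (yf j).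
    have := le_trans (cfun_ecoord_le (y j) f ((t m).1 l) ord0) (yf j).
    move: h; rewrite -/(r r0 j); set yk := ecoord (y j _) _.
    set yl := ecoord (y j _) _; set fk := ecoord (f _) _; set fl :=
      ecoord (f _) _.
    have := ler_distD fk yk yl; have := ler_distD fl fk yl.
    by rewrite (distrC fl yl); lra.
  move=> m; exists (t m).1 => k l j km lm jm kl nkl.
  rewrite -mulrA -[X in alpha * X]mulrC -/(r r0 j).
  have e2 : (2 ^ j.+1 = 2 ^ j + 2 ^ j)%N by rewrite expnS mul2n -addnn.
  (* Indices that agree modulo [2 ^ j] but not modulo [2 ^ j.+1] have residues modulo [2 ^ j.+1]
     differing by [2 ^ j], so their points descend from siblings. *)
  have mE i : (i %% 2 ^ j.+1 = i %% 2 ^ j \/ i %% 2 ^ j.+1 = i %% 2 ^ j + 2 ^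
    j)%N.
    have lt : (i %% 2 ^ j.+1 < 2 ^ j + 2 ^ j)%N by rewrite -e2 ltn_pmod//
      expn_gt0.
    rewrite -(@modn_dvdm (2 ^ j.+1) i (2 ^ j)) ?dvdn_exp2l//.
    move: lt; set i' := (i %% 2 ^ j.+1)%N => lt.
    have [i1|i1] := ltnP i' (2 ^ j); first by left; rewrite modn_small.
    right; rewrite -{2}(subnK i1) modnDr modn_small ?subnK//.
    by rewrite ltn_subLR.
  have lt i : (i %% 2 ^ j < 2 ^ j)%N by rewrite ltn_pmod// expn_gt0.
  have [k1|k1] := mE k; have [l1|l1] := mE l.
  + by case: nkl; rewrite k1 l1.
  + by apply: sep => //; rewrite k1 ?lt// l1 kl.
  + by rewrite metric_sym; apply: sep => //; rewrite l1 ?lt// k1 kl.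
  + by case: nkl; rewrite k1 l1 kl.
Qed.

Lemma uncountable_winning : ~ countable [set: K] ->
  winning [set f : F | (0 < hausdorff_dim (range f))%E].
Proof.
move=> nK; apply: winningS (separated_tree_winning nK) => f.
move=> [kappa [q [kappa0 q01 tree]]].
have [s [c [s0 c0 cf]]] := separated_tree_content kappa0 q01 tree.
apply: lt_le_trans (hausdorff_dim_ge c0 (cf 1)).
by rewrite lte_fin.
Qed.

End CantorGame.

(** * Values of the topological dimension *)

Section Topdim.
Context {R : realType} {K : metricType R}.

Lemma topdim_leW m n : (m <= n)%N -> topdim_le K m -> topdim_le K n.
Proof.
move=> mn Km r r0; have [C [KC Co Cm]] := Km r r0; exists C; split=> // x.
by apply: card_le_trans (Cm x) _; rewrite card_le_II.
Qed.

Lemma topdim_lt n : (topdim K < n.+1%:R%:E)%E -> topdim_le K n.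
Proof.
move=> /ereal_inf_ltP[_ [m Km <-]]; rewrite lte_fin ltr_nat ltnS => mn.
exact: topdim_leW Km.
Qed.

Lemma topdim_ge n : (n.+1%:R%:E <= topdim K)%E -> ~ topdim_le K n.
Proof.
move=> nK Kn; have : (topdim K <= n%:R%:E)%E by apply: ereal_inf_lbound;
  exists n.
by move=> /(le_trans nK); rewrite lee_fin ler_nat ltnn.
Qed.

Lemma topdim_finite n : (topdim K <= n%:R%:E)%E ->
  exists m, [/\ (m <= n)%N, topdim K = m%:R%:E &
    forall k, topdim_le K k -> (m <= k)%N].
Proof.
move=> Kn; have exK : exists m, `[< topdim_le K m >].
  exists n; apply/asboolP; apply: topdim_lt; apply: le_lt_trans Kn _.
  by rewrite lte_fin ltr_nat.
have [m /asboolP Km mmin] := ex_minnP exK.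
have KE : topdim K = m%:R%:E.
  apply/eqP; rewrite eq_le; apply/andP; split.
    by apply: ereal_inf_lbound; exists m.
  apply: le_ereal_inf_tmp => _ [k /asboolP/mmin mk <-].
  by rewrite lee_fin ler_nat.
exists m; split=> // [|k /asboolP/mmin//].
by move: Kn; rewrite KE lee_fin ler_nat.
Qed.

End Topdim.

Theorem theorem2p10 (R : realType) (K : metricType R)
    (cK : compact [set: K]) (K0 : [set: K] !=set0) (d : nat) (d1 : (1 <= d)%N) :
  let F := cfun (euclidean R d) cK in
  [/\ ((d%:R%:E <= topdim K)%E ->
         winning [set f : F | interior (range f) !=set0]),
      ((topdim K < d%:R%:E)%E ->
         winning [set f : F | (assouad_dim (range f) < d%:R%:E)%E]),
      (~ countable [set: K] ->
         winning [set f : F | (0 < hausdorff_dim (range f))%E]) &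
      ((topdim K <= d%:R%:E)%E ->
         winning [set f : F |
           (0 < hausdorff_measure (fine (topdim K)) (range f))%E] /\
         winning [set f : F | (topdim K <= hausdorff_dim (range f))%E])].
Proof.
case: d d1 => [//|d d1] F; split.
- move=> /topdim_ge nK.
  apply: (winningS (@fills_cube_interior R K cK d.+1)).
  apply: fills_cube_winning => // esc; apply: nK.
  exact: escapable_topdim_le.
- by move=> /topdim_lt/(topdim_le_escapable cK); exact: low_dim_winning.
- exact: uncountable_winning.
move=> /topdim_finite[n [nd nE nmin]].
suff : winning [set f : F | exists2 c : R, 0 < c &
    forall r, (c%:E <= hausdorff_content r n%:R (range f))%E].
  move=> W; rewrite nE /=; split; apply: winningS W => f [c c0 cf].
    apply: lt_le_trans (content_le_measure _ _ ltr01).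
    by apply: lt_le_trans (cf 1); rewrite lte_fin.
  exact: hausdorff_dim_ge c0 (cf 1).
case: n nE nd nmin => [|n] nE nd nmin.
  (* In dimension 0 every image is nonempty and has content at least 1, so any legal play wins. *)
  apply: (@one_move_winning _ _ (1 / 2)) => [|f r r0].
    by apply/andP; split; lra.
  exists f => [|g _]; first by rewrite mdistxx; lra.
  exists 1 => // r'; apply: content0_ge1.
  by have [x _] := K0; exists (g x), x.
apply: (winningS (S := [set f : F | fills_cube nd f])).
  by move=> f; exact: fills_cube_content.
apply: fills_cube_winning => // /(escapable_topdim_le cK)/nmin.
by rewrite ltnn.
Qed.
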